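(* Let $G$ be an infinite, connected, locally finite, quasi-transitive, simple rooted graph with root $\mathbf{0}$. Suppose that $G$ possesses a square graph height function and has sub-exponential growth. For $n\ge 3$, let $p_n$ be the number of $n$-step polygons of $G$ that include the root $\mathbf{0}$. Then $\pi(G):=\limsup_{n\to\infty}p_n^{1/n}$ satisfies $\pi(G)=\mu(G)$, where $\mu(G)$ is the connective constant of $G$.
   Context: Graphs $G=(V,E)$ are simple (no loops, no parallel edges), with root $\mathbf{0}\in V$. Write $u\sim v$ if $u,v$ are neighbours, $\partial v$ for the set of neighbours of $v$, and $d(u,v)$ for graph-distance. $\mathrm{Aut}(G)$ is the automorphism group. A subgroup of $\mathrm{Aut}(G)$ acts quasi-transitively if its action on $V$ has finitely many orbits; $G$ is quasi-transitive if $\mathrm{Aut}(G)$ acts quasi-transitively. A self-avoiding walk (SAW) is a path that visits no vertex more than once; it has $n$ steps if it has exactly $n$ edges. $c_n$ is the number of $n$-step SAWs starting at $\mathbf{0}$, and the connective constant is $\mu(G):=\lim_{n\to\infty}c_n^{1/n}$ (the limit is known to exist and does not depend on the choice of root). A polygon is a cycle of $G$ (with at least 3 distinct vertices, no repeated vertex, regarded as unoriented) containing $\mathbf{0}$; it has $n$ steps if it has exactly $n$ edges. Thus $2p_n$ is the number of $(n-1)$-step SAWs from $\mathbf{0}$ ending at a neighbour of $\mathbf{0}$ ($n\ge3$). A graph height function (ghf) on $G$ is a pair $(h,\mathcal H)$ such that: (a) $h:V\to\mathbb Z$ and $h(\mathbf 0)=0$; (b) $\mathcal H\le\mathrm{Aut}(G)$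 acts quasi-transitively on $G$ and $h(\alpha v)-h(\alpha u)=h(v)-h(u)$ for all $\alpha\in\mathcal H$, $u,v\in V$; (c) for every $v\in V$ there exist $u,w\in\partial v$ with $h(u)<h(v)<h(w)$. A square graph height function (square ghf) is a triple $(h,\mathcal H,\rho)$ where $(h,\mathcal H)$ is a ghf and $\rho\in\mathcal H$ satisfies: (a) $\rho$ is a translation, i.e. there is no non-empty finite set $F\subseteq V$ with $\rho(F)=F$; (b) $h(\rho(v))=h(v)$ for all $v\in V$; (c) $\rho$ commutes with every $\alpha\in\mathcal H$. Sub-exponential growth means $\lim_{n\to\infty}\frac1n\log\Gamma_n=0$, where $\Gamma_n=|\{v\in V:d(\mathbf 0,v)\le n\}|$. *)

(* Defs.v *)
From mathcomp Require Import all_boot all_order all_algebra.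
From mathcomp Require Import finmap.
From mathcomp Require Import all_classical all_reals.
From mathcomp Require Import ereal topology normedtype sequences exp.

Set Implicit Arguments.
Unset Strict Implicit.
Unset Printing Implicit Defensive.

Import Order.TTheory GRing.Theory Num.Theory.
Import numFieldNormedType.Exports.

Local Open Scope classical_set_scope.
Local Open Scope ring_scope.

(* A graph is an adjacency relation [e : rel V]; simplicity is the pair of
   hypotheses [symmetric e] and [irreflexive e].  The root is [o : V].  A walk
   from [u] is given by the sequence [p] of the vertices that follow [u], so
   that its number of steps is [size p]. *)

Definition graph_connected (V : choiceType) (e : rel V) : Prop :=
  forall u v, exists2 p, path e u p & last u p = v.

Definition locally_finite (V : choiceType) (e : rel V) : Prop :=
  forall v, finite_set [set u | e v u].

Definition walk_of_length (V : choiceType) (e : rel V) (u v : V) (n : nat)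
    : Prop :=
  exists p, [/\ path e u p, last u p = v & size p = n].

(* The value is 0 by convention when no walk joins [u] to [v]. *)
Definition graph_dist (V : choiceType) (e : rel V) (u v : V) : nat :=
  if pselect (exists n, `[< walk_of_length e u v n >]) is left ex
  then ex_minn ex else 0%N.

(* [fset_set] sends an infinite set to the empty set; the function is meant
   for finite sets. *)
Definition set_card (T : choiceType) (A : set T) : nat := #|` fset_set A|%N.

Definition growth (V : choiceType) (e : rel V) (o : V) (n : nat) : nat :=
  set_card [set v | (graph_dist e o v <= n)%N].

Definition subexponential_growth (R : realType) (V : choiceType) (e : rel V)
    (o : V) : Prop :=
  (fun n : nat => n%:R^-1 * ln (growth e o n)%:R : R) @ \oo --> (0 : R).

Definition automorphism (V : choiceType) (e : rel V) : set (V -> V) :=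
  [set f | bijective f /\ forall u v, e (f u) (f v) = e u v].

Definition aut_subgroup (V : choiceType) (e : rel V) (H : set (V -> V))
    : Prop :=
  [/\ H `<=` automorphism e,
      H id,
      forall f g, H f -> H g -> H (f \o g)
    & forall f, H f -> exists g, [/\ H g, cancel f g & cancel g f]].

Definition orbit_of (V : choiceType) (H : set (V -> V)) (v : V) : set V :=
  [set f v | f in H].

Definition acts_quasi_transitively (V : choiceType) (H : set (V -> V))
    : Prop :=
  finite_set (range (orbit_of H)).

Definition quasi_transitive (V : choiceType) (e : rel V) : Prop :=
  acts_quasi_transitively (automorphism e).

Definition saws (V : choiceType) (e : rel V) (o : V) (n : nat)
    : set (seq V) :=
  [set p | [/\ path e o p, uniq (o :: p) & size p = n]].

Definition connective_constant (R : realType) (V : choiceType) (e : rel V)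
    (o : V) : R :=
  limn (fun n : nat => (set_card (saws e o n))%:R `^ n%:R^-1 : R).

(* The edges of the closed walk visiting the vertices of [c] cyclically. *)
Definition cycle_edges (V : choiceType) (c : seq V) : {fset {fset V}} :=
  [fset [fset x; next c x]%fset | x in c]%fset.

(* An unoriented cycle is identified with its set of edges, so that neither
   the starting vertex nor the orientation of [c] matters. *)
Definition polygons (V : choiceType) (e : rel V) (o : V) (n : nat)
    : set {fset {fset V}} :=
  [set E | (3 <= n)%N /\
     exists c, [/\ size c = n, ucycle e c, o \in c & E = cycle_edges c]].

Definition polygon_constant (R : realType) (V : choiceType) (e : rel V)
    (o : V) : \bar R :=
  limn_esup
    (fun n : nat => ((set_card (polygons e o n))%:R `^ n%:R^-1 : R)%:E).

Definition graph_height_function (V : choiceType) (e : rel V) (o : V)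
    (h : V -> int) (H : set (V -> V)) : Prop :=
  [/\ h o = 0,
      aut_subgroup e H,
      acts_quasi_transitively H,
      forall f, H f -> forall u v, h (f v) - h (f u) = h v - h u
    & forall v, exists u w, [/\ e v u, e v w, h u < h v & h v < h w]].

Definition translation (V : choiceType) (f : V -> V) : Prop :=
  ~ exists F : set V, [/\ F !=set0, finite_set F & f @` F = F].

Definition square_graph_height_function (V : choiceType) (e : rel V) (o : V)
    (h : V -> int) (H : set (V -> V)) (rho : V -> V) : Prop :=
  [/\ graph_height_function e o h H,
      H rho,
      translation rho,
      forall v, h (rho v) = h v
    & forall f, H f -> rho \o f = f \o rho].

(* Main.v *)
Require Import Defs.
From mathcomp Require Import all_boot all_order all_algebra.
From mathcomp Require Import finmap.
From mathcomp Require Import all_classical all_reals.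
From mathcomp Require Import ereal topology normedtype sequences exp.
From mathcomp Require Import zify.

(** Write c_n for the number of n-step self-avoiding walks from the root and
    p_n for the number of n-step polygons through it.  Both growth rates are
    compared with the growth rate l of the number of bridges: self-avoiding
    walks that stay strictly above the height of their first vertex and end at
    their greatest height.

    Self-avoiding walks grow no faster than bridges, by the method of
    Hammersley and Welsh.  A walk cut at its last lowest vertex gives two
    half-space walks, and a half-space walk cut at its last highest vertex
    gives an upward bridge followed by a half-space walk for the height -h, of
    smaller span.  Iterating produces bridges of strictly decreasing spans,
    alternately upward and downward; since the height changes by a bounded
    amount along an edge, the length of a bridge is at least proportional to its
    span, and the resulting product over spans converges
    ([half_space_span_count], [saw_count_le]).  A downward bridge read
    backwards is an upward bridge whose first vertex is unknown; as balls grow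
    sub-exponentially, the number of candidates for that vertex does not affect
    growth rates, so upward bridges control downward ones.

    Any two orbits are joined by a bridge of bounded length
    ([bridge_connector]), so bridges may be taken to go from the root o to a
    vertex in the orbit of o.  Choosing the most popular end vertex again costs
    only a sub-exponential factor: for each t < l there are infinitely many m
    and an automorphism f for which at least t^m bridges lead from o to f o in
    m steps ([many_anchored_bridges]).  Concatenating images of such bridges
    under f shows that c_n is at least a constant times t^n for every n
    ([saw_count_ge]).  Hence c_n^(1/n) converges to l.

    Deleting an edge at the root turns a polygon into a self-avoiding walk, so
    limsup p_n^(1/n) is at most l.  Conversely, let p and p' be two m-step
    bridges from o to f o.  Their images under the powers of f form two
    f-invariant bi-infinite paths.  Moving the second one by the powers of rho,
    which commutes with f and preserves heights, there is a first power for
    which the two paths are disjoint; one power earlier they still met, so they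
    are now at distance at most the displacement D of rho.  A shortest path
    between them, its image under f, and the arcs of the two paths in between
    form a polygon of 2m + O(1) steps through a translate of o ([connection],
    [closing_cycleP]).  The polygon together with polynomially much information
    determines the pair (p, p') ([closing_cycle_inj]), so some p_n with
    n = 2m + O(1) is at least t^(2m) up to a polynomial factor
    ([many_polygons]). *)

Set Implicit Arguments.
Unset Strict Implicit.
Unset Printing Implicit Defensive.

Import Order.TTheory GRing.Theory Num.Theory.
Import numFieldNormedType.Exports.

Local Open Scope classical_set_scope.

(** * Counting *)

(** Injections are used here in relational form: the code b of a is obtained
    from existence statements, and only decoding has to be unique. *)
Lemma size_le_code (A B : eqType) (s : seq A) (t : seq B) (r : A -> B -> Prop) :
  uniq s ->
  (forall a, a \in s -> exists2 b, b \in t & r a b) ->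
  (forall a a' b, a \in s -> a' \in s -> b \in t -> r a b -> r a' b -> a = a') ->
  (size s <= size t)%N.
Proof.
elim: s t => [//|a s IH] t /= /andP[a_s us] tot inj.
have [b bt rab] := tot a (mem_head _ _).
have lt_t : (size [seq c <- t | c != b] < size t)%N.
  rewrite size_filter -(count_predC (pred1 b) t) addnC -{1}[count _ t]addn0.
  by rewrite ltn_add2l -has_count has_pred1.
apply: leq_ltn_trans lt_t; apply: IH => // [a' a's|a1 a2 b' s1 s2].
  have a'S : a' \in a :: s by rewrite inE a's orbT.
  have [b' b't ra'b'] := tot a' a'S; exists b' => //.
  rewrite mem_filter b't andbT; apply: contraNneq a_s => eb'.
  rewrite eb' in ra'b'.
  by rewrite (inj a a' b (mem_head _ _) a'S bt rab ra'b').
rewrite mem_filter => /andP[_ b't]; apply: inj => //.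
- by rewrite inE s1 orbT.
- by rewrite inE s2 orbT.
Qed.

Lemma popular_value (A B : eqType) (s : seq A) (f : A -> B) (E : seq B) :
  (0 < size s)%N -> (forall a, a \in s -> f a \in E) ->
  exists2 z, z \in E & (size s <= size E * count (fun a => f a == z) s)%N.
Proof.
move=> s0 fE; apply/hasP; apply: contraT => /hasPn small.
have sum_ge : (size s <= \sum_(z <- E) count (fun a => f a == z) s)%N.
  have -> : \sum_(z <- E) count (fun a => f a == z) s
      = \sum_(a <- s) count (fun z => f a == z) E.
    under eq_bigr do rewrite -sum1_count big_mkcond.
    rewrite exchange_big /=; apply: eq_bigr => a _.
    by rewrite -big_mkcond sum1_count.
  rewrite -sum1_size; rewrite big_seq [X in (_ <= X)%N]big_seq.
  apply: leq_sum => a /fE aE; rewrite -has_count; apply/hasP.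
  by exists (f a).
have : (size E * size s <= size E * (size s).-1)%N.
  apply: (leq_trans (n := size E * \sum_(z <- E) count (fun a => f a == z) s)).
    by rewrite leq_mul2l sum_ge orbT.
  rewrite big_distrr /= big_seq.
  apply: (leq_trans (n := \sum_(z <- E | z \in E) (size s).-1)).
    apply: leq_sum => z /small; rewrite -ltnNge; lia.
  by rewrite -big_seq big_const_seq count_predT iter_addn_0 mulnC.
have : (0 < size E)%N.
  by case: s s0 fE {small sum_ge} => // a s _ /(_ _ (mem_head _ _)); case: E.
nia.
Qed.

Section SizeReal.
Variable R : realType.
Local Open Scope ring_scope.

(** The union bound behind all counts below: a set of walks is covered by the
    concatenations of an outer choice a with an inner choice among t a. *)
Lemma size_allpairs_le (A : eqType) (B C : Type) (s : seq A) (t : A -> seq B)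
    (f : A -> B -> C) (c : A -> R) (x : R) :
  (forall a, a \in s -> (size (t a))%:R <= c a) -> \sum_(a <- s) c a <= x ->
  (size [seq f a b | a <- s, b <- t a])%:R <= x.
Proof.
move=> le_c le_x; apply: le_trans le_x.
elim: s le_c => [_|a s IH le_c]; first by rewrite big_nil.
rewrite big_cons /= size_cat natrD size_map lerD ?le_c ?mem_head//.
by apply: IH => y ys; apply: le_c; rewrite inE ys orbT.
Qed.

End SizeReal.

Lemma set_cardE (T : choiceType) (A : set T) (s : seq T) :
  uniq s -> (forall x, A x <-> x \in s) -> set_card A = size s.
Proof.
move=> us As; have -> : A = [set` [fset x in s]%fset].
  by apply/seteqP; split=> x /=; rewrite in_fset /= => /As.
by rewrite /set_card set_fsetK card_fseq undup_id.
Qed.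

Lemma last_splitP (T : Type) (a : pred T) (s : seq T) : has a s ->
  exists s1 x s2, [/\ s = rcons s1 x ++ s2, a x & ~~ has a s2].
Proof.
elim: s => [//|y s IH] /=.
have [/IH [s1 [x [s2 [-> ax ns2]]]] _|nas] := boolP (has a s).
  by exists (y :: s1), x, s2.
by rewrite orbF => ay; exists [::], y, s.
Qed.

Lemma last_rev_belast (T : Type) (x : T) (s : seq T) :
  last (last x s) (rev (belast x s)) = x.
Proof. by case: s => //= y s; rewrite rev_cons last_rcons. Qed.

(** * Walks *)

Section Walks.
Variables (V : choiceType) (e : rel V).
Hypothesis e_lf : locally_finite e.

Definition neighbours (v : V) : seq V := fset_set [set u | e v u].

Lemma mem_neighbours v u : (u \in neighbours v) = e v u.
Proof.
rewrite /neighbours in_fset_set; last exact: e_lf.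
by apply/idP/idP; rewrite inE.
Qed.

Fixpoint walks (v : V) (n : nat) : seq (seq V) :=
  if n is m.+1 then [seq u :: p | u <- neighbours v, p <- walks u m]
  else [:: [::]].

Lemma mem_walks v n p : (p \in walks v n) = path e v p && (size p == n).
Proof.
elim: n v p => [|n IH] v p /=.
  by rewrite inE; case: p => [|x p] //=; rewrite andbF.
apply/allpairsPdep/andP => [[u [q [+ + ->]]]|].
  by rewrite mem_neighbours IH /= eqSS => -> /andP[-> ->].
case: p => [[]//|u q [/= /andP[evu pq]] sq].
by exists u, q; rewrite mem_neighbours IH pq -eqSS sq.
Qed.

Lemma uniq_walks v n : uniq (walks v n).
Proof.
elim: n v => //= n IH v; apply: allpairs_uniq_dep => //.
- exact: fset_uniq.
- by move=> [u p] [u' p'] _ _ /= [-> ->].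
Qed.

Lemma size_walks_le D v n : (forall u, size (neighbours u) <= D)%N ->
  (size (walks v n) <= D ^ n)%N.
Proof.
move=> leD; elim: n v => //= n IH v.
rewrite size_allpairs_dep expnS.
apply: (@leq_trans (sumn [seq (D ^ n)%N | _ <- neighbours v])).
  by elim: (neighbours v) => //= u s IHs; rewrite leq_add.
have -> : sumn [seq (D ^ n)%N | _ <- neighbours v]
    = (size (neighbours v) * D ^ n)%N.
  by elim: (neighbours v) => //= u s ->; rewrite mulSn.
by rewrite leq_mul2r leD orbT.
Qed.

Definition walks_with (P : pred (seq V)) v n := [seq p <- walks v n | P p].

Lemma mem_walks_with (P : pred (seq V)) v n p :
  (p \in walks_with P v n) = [&& P p, path e v p & size p == n].
Proof. by rewrite mem_filter mem_walks. Qed.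

Lemma uniq_walks_with (P : pred (seq V)) v n : uniq (walks_with P v n).
Proof. by rewrite filter_uniq ?uniq_walks. Qed.

(** Every loss of a factor through a pigeonhole or a sum over unknown end
    vertices is measured by the size of this list, which lies in a ball. *)
Definition walk_ends v n : seq V := undup [seq last v p | p <- walks v n].

Lemma mem_walk_ends v p : path e v p -> last v p \in walk_ends v (size p).
Proof.
by move=> pp; rewrite mem_undup; apply: map_f; rewrite mem_walks pp eqxx.
Qed.

End Walks.

(** * Quasi-transitive actions *)

Section Action.
Variables (V : choiceType) (e : rel V) (o : V) (h : V -> int)
  (H : set (V -> V)).
Hypotheses (e_sym : symmetric e) (e_lf : locally_finite e)
  (e_conn : graph_connected e) (ghf : graph_height_function e o h H).

Lemma act_inj f : H f -> injective f.
Proof.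
by case: ghf => _ [aut _ _ _] _ _ _ /aut[/bij_inj].
Qed.

Lemma act_edge f u v : H f -> e (f u) (f v) = e u v.
Proof. by case: ghf => _ [aut _ _ _] _ _ _ /aut[]. Qed.

Lemma act_comp f g : H f -> H g -> H (f \o g).
Proof. by case: ghf => _ [_ _ comp _] _ _ _; apply: comp. Qed.

Lemma act_id : H id.
Proof. by case: ghf => _ [_ Hid _ _] _ _ _. Qed.

Lemma act_inv f : H f -> exists g, [/\ H g, cancel f g & cancel g f].
Proof. by case: ghf => _ [_ _ _ inv] _ _ _; apply: inv. Qed.

Lemma act_height f u v : H f -> (h (f v) - h (f u) = h v - h u)%R.
Proof. by case: ghf => _ _ _ diff _ Hf; apply: diff. Qed.

Lemma act_path f v p : H f -> path e (f v) [seq f y | y <- p] = path e v p.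
Proof.
by move=> Hf; elim: p v => //= u p IH v; rewrite act_edge// IH.
Qed.

Lemma orbit_representatives : exists s : seq V,
  forall v, exists2 f, H f & exists2 r, r \in s & v = f r.
Proof.
case: ghf => _ _ /finite_seqP[s sE] _ _.
exists [seq xget o [set v | orbit_of H v = A] | A <- s] => v.
have : [set` s] (orbit_of H v) by rewrite -sE; exists v.
move=> /= Os; set A := orbit_of H v in Os.
set r := xget o [set v | orbit_of H v = A].
have rO : orbit_of H r = A by apply: (@xgetPex _ o [set v | orbit_of H v = A]); exists v.
have : A v by exists id => //; exact: act_id.
rewrite -rO => -[f Hf frv]; exists f => //; exists r => //.
by apply/mapP; exists A.
Qed.

(** An invariant quantity that is finite at each vertex takes finitely many
    values, one per orbit, hence is bounded. *)
Lemma uniform_bound (Q : V -> nat -> Prop) :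
  (forall v, exists n, Q v n) ->
  (forall v m n, (m <= n)%N -> Q v m -> Q v n) ->
  (forall f v n, H f -> Q v n -> Q (f v) n) ->
  exists n, forall v, Q v n.
Proof.
move=> ex mono inv; have [s sP] := orbit_representatives.
suff [n nP] : exists n, forall r, r \in s -> Q r n.
  by exists n => v; have [f Hf [r rs ->]] := sP v; apply: inv => //; apply: nP.
elim: s {sP} => [|r s [n nP]]; first by exists 0%N.
have [m Qm] := ex r; exists (maxn m n) => r'.
rewrite inE => /predU1P[->|/nP Qn]; first exact: (mono _ _ _ (leq_maxl m n) Qm).
exact: (mono _ _ _ (leq_maxr m n) Qn).
Qed.

Lemma neighbours_bound : exists D, forall v, (size (neighbours e v) <= D)%N.
Proof.
apply: (@uniform_bound (fun v n => (size (neighbours e v) <= n)%N)).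
- by move=> v; exists (size (neighbours e v)).
- by move=> v m n mn /leq_trans; apply.
move=> f v n Hf; apply: leq_trans.
have [g [Hg fg gf]] := act_inv Hf.
rewrite -(size_map f (neighbours e v)); apply: uniq_leq_size; first exact: fset_uniq.
move=> u; rewrite mem_neighbours// => efvu.
rewrite -[u]gf; apply: map_f.
by rewrite mem_neighbours// -(act_edge _ _ Hf) gf.
Qed.

Lemma height_step_bound : exists c : nat,
  forall u v, e u v -> (h v <= h u + c%:Z)%R.
Proof.
have [c cP] : exists c : nat, forall u, forall v, e u v -> (h v <= h u + c%:Z)%R.
  apply: (@uniform_bound (fun u n => forall v, e u v -> (h v <= h u + n%:Z)%R)).
  - move=> u.
    exists (\max_(v <- neighbours e u) absz (h v - h u)%R) => v euv.
    have : (`|(h v - h u)%R|%N <= \max_(w <- neighbours e u) absz (h w - h u)%R)%N.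
      rewrite (big_rem v) ?mem_neighbours//=; exact: leq_maxl.
    lia.
  - move=> u m n mn le_m v /le_m; lia.
  move=> f u n Hf le_n v efuv; have [g [Hg fg gf]] := act_inv Hf.
  have := le_n (g v); rewrite -(act_edge _ _ Hf) gf => /(_ efuv).
  have := act_height u (g v) Hf; rewrite gf; lia.
by exists c => u v; apply: cP.
Qed.

Lemma orbit_distance_bound : exists D : nat, forall u v,
  exists2 f, H f & exists p, [/\ path e u p, last u p = f v & (size p <= D)%N].
Proof.
pose W u v n := exists2 f, H f &
  exists p, [/\ path e u p, last u p = f v & (size p <= n)%N].
apply: (@uniform_bound (fun u n => forall v, W u v n)).
- move=> u; apply: (@uniform_bound (W u)).
  + move=> v; have [p pp lp] := e_conn u v; exists (size p), id; first exact: act_id.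
    by exists p.
  + move=> v m n mn [f Hf [p [pp lp sp]]]; exists f => //; exists p; split=> //.
    exact: leq_trans mn.
  move=> g v n Hg [f Hf [p [pp lp sp]]]; have [g' [Hg' gg' g'g]] := act_inv Hg.
  exists (f \o g'); first exact: act_comp.
  by exists p; split => //=; rewrite gg'.
- move=> u m n mn le_m v; have [f Hf [p [pp lp sp]]] := le_m v.
  by exists f => //; exists p; split=> //; exact: leq_trans mn.
move=> g u n Hg le_n v; have [f Hf [p [pp lp sp]]] := le_n v.
exists (g \o f); first exact: act_comp.
by exists [seq g y | y <- p]; rewrite act_path// last_map lp size_map.
Qed.

(** Since rho commutes with the action, the distance from v to rho v depends
    only on the orbit of v. *)
Lemma central_displacement_bound rho : H rho ->
  (forall f, H f -> rho \o f = f \o rho) ->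
  exists D : nat, forall v, exists p,
    [/\ path e v p, last v p = rho v & (size p <= D)%N].
Proof.
move=> Hrho comm; apply: (@uniform_bound (fun v n => exists p,
    [/\ path e v p, last v p = rho v & (size p <= n)%N])).
- by move=> v; have [p pp lp] := e_conn v (rho v); exists (size p), p.
- move=> v m n mn [p [pp lp sp]]; exists p; split=> //; exact: leq_trans mn.
move=> f v n Hf [p [pp lp sp]]; exists [seq f y | y <- p].
rewrite act_path// last_map lp size_map; split=> //.
by have /(congr1 (fun k => k v)) := comm _ Hf.
Qed.

Lemma dist_le v p : path e o p -> last o p = v ->
  (graph_dist e o v <= size p)%N.
Proof.
move=> pp lp; rewrite /graph_dist; case: pselect => [ex|//].
case: ex_minnP => m _; apply; apply/asboolP; by exists p.
Qed.

Lemma dist_walk v : exists p,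
  [/\ path e o p, last o p = v & size p = graph_dist e o v].
Proof.
rewrite /graph_dist; case: pselect => [ex|nex].
  by case: ex_minnP => m /asboolP.
by exfalso; apply: nex; have [p pp lp] := e_conn o v;
  exists (size p); apply/asboolP; exists p.
Qed.

Lemma growthE n : growth e o n =
  size (undup (flatten [seq walk_ends e o m | m <- iota 0 n.+1])).
Proof.
apply: set_cardE => [|v]; first exact: undup_uniq.
rewrite mem_undup; split.
  move=> le_n; have [p [pp lp sp]] := dist_walk v.
  apply/flattenP; exists (walk_ends e o (size p)).
    by apply: map_f; rewrite mem_iota sp.
  by rewrite -lp mem_walk_ends.
case/flattenP => s /mapP[m]; rewrite mem_iota add0n ltnS => /= mn ->.
rewrite mem_undup => /mapP[p]; rewrite mem_walks// => /andP[pp /eqP sp] ->.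
by apply: (leq_trans (dist_le pp erefl)); rewrite sp.
Qed.

(** A translate of the root lies within distance D of v, so that the ball of
    radius n about v is carried into the ball of radius n + D about o. *)
Lemma size_walk_ends_le : exists D : nat, forall v n,
  (size (walk_ends e v n) <= growth e o (n + D))%N.
Proof.
have [D DP] := orbit_distance_bound; exists D => v n.
have [f Hf [p [pp lp sp]]] := DP v o.
have [g [Hg fg gf]] := act_inv Hf.
rewrite growthE -(size_map g); apply: uniq_leq_size.
  by rewrite map_inj_uniq ?undup_uniq//; apply: act_inj.
move=> u /mapP[w]; rewrite [w \in _]mem_undup => /mapP[q].
rewrite mem_walks// => /andP[pq /eqP sq] -> ->.
rewrite mem_undup; apply/flattenP.
(* the walk from f o back to v, followed by q, is moved by g to one from o *)
pose r := [seq g y | y <- rev (belast v p) ++ q].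
have pr : path e o r.
  rewrite -[o]fg -lp act_path// cat_path last_rev_belast pq andbT.
  by rewrite rev_path (@eq_path _ _ e)// => x y; exact: e_sym.
exists (walk_ends e o (size r)).
  apply: map_f; rewrite mem_iota add0n ltnS leq0n /= /r size_map size_cat.
  by rewrite size_rev size_belast sq addnC leq_add2l.
have <- : last o r = g (last v q).
  by rewrite -[o in LHS]fg -lp last_map last_cat last_rev_belast.
exact: mem_walk_ends.
Qed.

End Action.

(** * Exponential bounds *)

Section ExpBounds.
Variable R : realType.
Implicit Types t y x th tau : R.
Local Open Scope ring_scope.

(** The parameter th measures the room between two rates t < y; taking its
    power k leaves k independent factors to be spent on lower-order losses. *)
Lemma exists_root_between (k : nat) t y : 0 < t -> t < y ->
  exists th, [/\ 0 < th, th < 1 & t <= th ^+ k * y].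
Proof.
move=> t0 ty; have y0 : 0 < y by apply: lt_trans ty.
have q0 : 0 < t / y by rewrite divr_gt0.
have lnq : ln (t / y) < 0 by rewrite ln_lt0// q0 ltr_pdivrMr// mul1r.
exists (expR (ln (t / y) / k.+1%:R)); split.
- exact: expR_gt0.
- by rewrite expR_lt1 pmulr_llt0// invr_gt0.
rewrite -ler_pdivrMr// -expRM_natl -[leLHS]lnK ?posrE// ler_expR.
rewrite mulrA ler_pdivlMr// mulrC ler_wnM2r ?ltW//.
by rewrite ltr_nat.
Qed.

Lemma sum_geometric_le x n : 0 < x -> x < 1 ->
  \sum_(i <- iota 0 n) x ^+ i <= (1 - x)^-1.
Proof.
move=> x0 x1; have := @geometric_le_lim R n 1 x ler01 x0.
rewrite gtr0_norm// mul1r => /(_ x1); apply: le_trans.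
rewrite /series /= big_mkord -[X in iota X n]/0%N -{1}(subn0 n).
rewrite -[iota 0 (n - 0)]/(index_iota 0 n) big_mkord.
by apply: ler_sum => i _; rewrite mul1r.
Qed.

Lemma linear_le_exponential tau : 1 < tau ->
  exists2 K : R, 0 < K & forall n : nat, n.+1%:R <= K * tau ^+ n.
Proof.
move=> tau1; have t0 : 0 < tau by apply: lt_trans tau1.
have L0 : 0 < ln tau by rewrite ln_gt0.
exists (1 + (ln tau)^-1); first by rewrite addr_gt0 ?invr_gt0.
move=> n; rewrite -[tau]lnK ?posrE// -expRM_natl expRK.
apply: (@le_trans _ _ ((1 + (ln tau)^-1) * (1 + n%:R * ln tau))); last first.
  by rewrite ler_wpM2l ?expR_ge1Dx// addr_ge0// invr_ge0 ltW.
rewrite mulrDl mul1r mulrDr mulr1 (mulrC n%:R) (mulrA _^-1) mulVf ?gt_eqF//.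
rewrite !mul1r -natr1 addrC -addrA lerD2l addrA lerDr.
by rewrite addr_ge0 ?invr_ge0 ?mulr_ge0 // ltW.
Qed.

(** Each factor is at most the exponential of a geometric term, so the product
    stays bounded as n grows. *)
Lemma prod_geometric_le a th n : 0 <= a -> 0 < th -> th < 1 ->
  \prod_(j < n) (1 + a * th ^+ j) <= expR (a / (1 - th)).
Proof.
move=> a0 th0 th1.
apply: (@le_trans _ _ (\prod_(j < n) expR (a * th ^+ j))).
  apply: ler_prod => j _; rewrite expR_ge1Dx andbT.
  by rewrite addr_ge0// mulr_ge0// exprn_ge0// ltW.
rewrite -expR_sum ler_expR -mulr_sumr ler_wpM2l//.
have := @sum_geometric_le th n th0 th1.
by rewrite -{1}(subn0 n) -[iota 0 (n - 0)]/(index_iota 0 n) big_mkord.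
Qed.

End ExpBounds.

Lemma subexponential_bound (R : realType) (V : choiceType) (e : rel V) (o : V)
    (tau : R) : (1 < tau)%R -> subexponential_growth R e o ->
  exists2 G : R, (0 < G)%R & forall n, ((growth e o n)%:R <= G * tau ^+ n)%R.
Proof.
move=> tau1 sub; have L0 : (0 < ln tau)%R by rewrite ln_gt0.
have t0 : (0 < tau)%R by apply: lt_trans tau1.
have [N _ NP] : \forall n \near \oo, (n%:R^-1 * ln (growth e o n)%:R < ln tau :> R)%R.
  by apply: cvgr_lt L0.
have bigN n : (N.+1 <= n)%N -> ((growth e o n)%:R <= tau ^+ n :> R)%R.
  move=> Nn; have := NP n (ltnW Nn) => /=.
  have n0 : (0 < n%:R :> R)%R by rewrite ltr0n (leq_trans _ Nn).
  rewrite mulrC ltr_pdivrMr//.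
  case: (growth e o n) => [|k]; first by rewrite exprn_ge0// ltW.
  move=> lt_ln; rewrite -[leLHS]lnK ?posrE ?ltr0n// -[tau]lnK ?posrE//.
  by rewrite -expRM_natr ler_expR ltW.
pose M := (\max_(i < N.+1) growth e o i)%N.
exists (1 + M%:R)%R; first by rewrite (lt_le_trans ltr01)// lerDl.
move=> n; have [Nn|nN] := leqP N.+1 n.
  apply: le_trans (bigN n Nn) _; rewrite ler_peMl ?exprn_ge0 ?lerDl//.
  exact: ltW.
apply: (@le_trans _ _ (1 + M%:R)%R).
  rewrite ler_wpDl// ler_nat /M -[n]/(nat_of_ord (Ordinal nN)).
  by apply: (leq_bigmax (F := fun i : 'I_N.+1 => growth e o i)).
by rewrite ler_peMr ?addr_ge0// exprn_ege1// ltW.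
Qed.

(** * Bridges and half-space walks *)

Section Bridges.
Variables (V : choiceType) (e : rel V).

Definition half_space_walk (g : V -> int) v p :=
  [&& path e v p, uniq (v :: p) & all (fun y => (g v < g y)%R) p].

(** The last vertex may share its height with others while the first vertex is
    strictly lowest; this asymmetry is what makes concatenation of bridges
    self-avoiding. *)
Definition bridge (g : V -> int) v p :=
  half_space_walk g v p && all (fun y => (g y <= g (last v p))%R) p.

Lemma bridge_path g v p : bridge g v p -> path e v p.
Proof. by case/andP => /and3P[]. Qed.

Lemma bridge_uniq g v p : bridge g v p -> uniq (v :: p).
Proof. by case/andP => /and3P[]. Qed.

Lemma bridge_gt g v p y : bridge g v p -> y \in p -> (g v < g y)%R.
Proof. by case/andP => /and3P[_ _ /allP]; move=> + _; apply. Qed.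

Lemma bridge_le_last g v p y :
  bridge g v p -> y \in v :: p -> (g y <= g (last v p))%R.
Proof.
move=> bp; rewrite inE => /predU1P[->|yp]; last by case/andP: bp => _ /allP ->.
case: p bp => [//|x p] bp.
have := bridge_gt bp (mem_last x p) => /=; lia.
Qed.

Lemma bridgeP g v p : path e v p -> uniq (v :: p) ->
  (forall y, y \in p -> (g v < g y)%R /\ (g y <= g (last v p))%R) ->
  bridge g v p.
Proof.
move=> pp up le; rewrite /bridge /half_space_walk pp up /=.
by apply/andP; split; apply/allP => y /le[].
Qed.

Lemma bridge_cat g v p q :
  bridge g v p -> bridge g (last v p) q -> bridge g v (p ++ q).
Proof.
move=> bp bq; have above y : y \in q -> (g (last v p) < g y)%R := bridge_gt bq.
apply: bridgeP.
- by rewrite cat_path (bridge_path bp) (bridge_path bq).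
- rewrite -cat_cons cat_uniq (bridge_uniq bp) /=.
  have /= /andP[_ ->] := bridge_uniq bq; rewrite andbT -all_predC.
  apply/allP => y yq /=; apply/negP => /(bridge_le_last bp).
  by have := above y yq; lia.
move=> y; rewrite last_cat mem_cat => /orP[yp|yq].
  split; first exact: bridge_gt yp.
  have lq := bridge_le_last bq (mem_head _ _).
  have := bridge_le_last bp (y := y); rewrite inE yp orbT => /(_ isT); lia.
split; last by apply: (bridge_le_last bq); rewrite inE yq orbT.
have := bridge_le_last bp (mem_head v p); have := above y yq; lia.
Qed.

End Bridges.

(** * Self-avoiding walks grow no faster than bridges *)

Section HammersleyWelsh.
Variables (V : choiceType) (e : rel V) (R : realType).
Hypotheses (e_sym : symmetric e) (e_lf : locally_finite e).
Local Open Scope ring_scope.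

Definition half_space_walk_span (g : V -> int) (s : nat) v p :=
  half_space_walk e g v p && all (fun y => g y <= g v + s%:Z) p.

Definition bridge_span (g : V -> int) (s : nat) v p :=
  bridge e g v p && (g (last v p) == g v + s%:Z).

(** Cut at the last vertex of height g v + s.+1, if there is one: what precedes
    is a bridge of span exactly s.+1, and what follows stays strictly below the
    cut and strictly above v, so for -g it is a half-space walk of span at most
    s. *)
Lemma half_space_walk_split (g g' : V -> int) s v p :
  (forall y, g' y = - g y) -> half_space_walk_span g s.+1 v p ->
  half_space_walk_span g s v p \/
  exists p1 p2, [/\ p = p1 ++ p2, bridge_span g s.+1 v p1
    & half_space_walk_span g' s (last v p1) p2].
Proof.
move=> gg' /andP[hp sp]; have /and3P[pp up gtp] := hp.
have [top|ntop] := boolP (has (fun y => g y == g v + s.+1%:Z) p); last first.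
  left; rewrite /half_space_walk_span hp; apply/allP => y yp.
  have /allP/(_ y yp) := sp; move/hasPn: ntop => /(_ y yp) /eqP; lia.
right; have [p1 [x [p2 [pE /eqP gx nx]]]] := last_splitP top.
exists (rcons p1 x), p2; split=> //.
  rewrite /bridge_span last_rcons gx eqxx andbT.
  move: pp up; rewrite pE cat_path -cat_cons cat_uniq => /andP[pp1 _] /andP[up1 _].
  apply: bridgeP => // y yp; have yp' : y \in p by rewrite pE mem_cat yp.
  by rewrite last_rcons gx; split; [apply: (allP gtp)|apply: (allP sp)].
rewrite last_rcons /half_space_walk_span /half_space_walk.
move: (pp) (up); rewrite pE cat_path last_rcons => /andP[_ ->].
rewrite cat_rcons -cat_cons cat_uniq => /and3P[_ _ ->] /=.
apply/andP; split; apply/allP => y yp; have yp' : y \in p by rewrite pE mem_cat yp orbT.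
  rewrite !gg' gx; have /allP/(_ y yp') := sp; move/hasPn: nx => /(_ y yp) /eqP.
  lia.
rewrite !gg' gx; have /allP/(_ y yp') := gtp; lia.
Qed.

Lemma path_height_le (g : V -> int) (c : nat) v p :
  (forall x y, e x y -> g y <= g x + c%:Z) -> path e v p ->
  forall y, y \in v :: p -> g y <= g v + (c * size p)%:Z.
Proof.
move=> step; elim: p v => [|x p IH] v /=.
  by move=> _ y; rewrite inE => /eqP ->; lia.
move=> /andP[/step vx /IH le] y; rewrite inE => /predU1P[->|/le]; nia.
Qed.

Section Rates.
Variables (c : nat) (K t y th : R).
Hypotheses (K0 : 0 < K) (t0 : 0 < t) (y0 : 0 < y) (th0 : 0 < th) (th1 : th < 1)
  (t_le : t <= th ^+ c.+1 * y).

Definition bridges_bounded (g : V -> int) :=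
  forall v n, (size (walks_with e (bridge e g v) v n))%:R <= K * t ^+ n.

(** A bridge of span s.+1 has at least s.+1 / c steps, so one factor th ^+ c
    per step yields the decay th ^+ s in the span, and the remaining factor th
    per step makes the sum over lengths converge. *)
Lemma bridge_span_count (g : V -> int) s v n :
  (forall u w, e u w -> g w <= g u + c%:Z) -> bridges_bounded g ->
  (size (walks_with e (bridge_span g s.+1 v) v n))%:R
    <= th ^+ n * (K * th ^+ s) * y ^+ n.
Proof.
move=> step bb; have [s_le|s_gt] := leqP s.+1 (c * n)%N; last first.
  suff -> : walks_with e (bridge_span g s.+1 v) v n = [::].
    by rewrite /= !mulr_ge0 ?exprn_ge0// ltW.
  apply/eqP; rewrite -size_eq0 size_filter -leqn0 leqNgt -has_count.
  apply/hasPn => p; rewrite mem_walks// => /andP[pp /eqP sp].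
  apply/negP => /andP[_ /eqP].
  have := path_height_le step pp (mem_last v p); rewrite sp.
  move: s_gt; set k := (c * n)%N; move: (g _) (g _) => a b; lia.
apply: (@le_trans _ _ (K * t ^+ n)).
  apply: le_trans (bb v n); rewrite ler_nat; apply: uniq_leq_size.
    exact: uniq_walks_with.
  by move=> p; rewrite !mem_walks_with// => /and3P[/andP[-> _] -> ->].
rewrite [_ * (K * _)]mulrCA -!mulrA ler_wpM2l ?(ltW K0)//.
apply: (@le_trans _ _ ((th ^+ c.+1 * y) ^+ n)).
  by rewrite lerXn2r ?nnegrE ?mulr_ge0 ?exprn_ge0// ltW.
rewrite exprMn -exprM mulSn exprD -mulrA !ler_wpM2l ?exprn_ge0 ?(ltW th0)//.
rewrite ler_wpM2r ?exprn_ge0 ?(ltW y0)//.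
by rewrite ler_wiXn2l // ?(ltW th0) ?(ltW th1)// ltnW.
Qed.

Lemma half_space_count_step (g g' : V -> int) s v n :
  (forall u, g' u = - g u) ->
  (size (walks_with e (half_space_walk_span g s.+1 v) v n) <=
   size (walks_with e (half_space_walk_span g s v) v n) +
   size [seq q | m <- iota 0 n.+1,
      q <- [seq p1 ++ p2 | p1 <- walks_with e (bridge_span g s.+1 v) v m,
        p2 <- walks_with e (half_space_walk_span g' s (last v p1)) (last v p1)
          (n - m)%N]])%N.
Proof.
move=> gg'; rewrite -size_cat; apply: uniq_leq_size; first exact: uniq_walks_with.
move=> p; rewrite mem_cat !mem_walks_with// => /and3P[hp pp /eqP sp].
have [->|[p1 [p2 [pE b1 h2]]]] := half_space_walk_split gg' hp.
  by rewrite pp sp eqxx.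
apply/orP; right; apply/allpairsPdep; exists (size p1), p.
have /andP[pp1 pp2] : path e v p1 && path e (last v p1) p2.
  by rewrite -cat_path -pE.
split=> //; first by rewrite mem_iota /= add0n ltnS -sp pE size_cat leq_addr.
apply/allpairsPdep; exists p1, p2; split=> //.
  by rewrite mem_walks_with// b1 pp1 eqxx.
by rewrite mem_walks_with// h2 pp2 -sp pE size_cat addKn eqxx.
Qed.

Local Notation A := (K / (1 - th)).

(** Induction on the span by [half_space_walk_split]: allowing the span s.+1
    multiplies the bound by 1 plus the total weight of bridges of that span,
    which is at most A * th ^+ s.  The heights g and g' = -g are treated
    together because the remainder of a walk is measured by the other one. *)
Lemma half_space_span_count s : forall (g g' : V -> int) v n,
  (forall u, g' u = - g u) ->
  (forall u w, e u w -> g w <= g u + c%:Z) -> bridges_bounded g ->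
  bridges_bounded g' ->
  (size (walks_with e (half_space_walk_span g s v) v n))%:R
    <= \prod_(j < s) (1 + A * th ^+ j) * y ^+ n.
Proof.
have A0 : 0 <= A by rewrite mulr_ge0 ?invr_ge0 ?subr_ge0 ?(ltW K0) ?(ltW th1).
elim: s => [|s IH] g g' v n gg' step bb bb'.
  rewrite big_ord0 mul1r; case: n => [|n].
    by rewrite expr0 /walks_with /= lexx.
  suff -> : walks_with e (half_space_walk_span g 0 v) v n.+1 = [::].
    by rewrite exprn_ge0// ltW.
  apply/eqP; rewrite -size_eq0 size_filter -leqn0 leqNgt -has_count.
  apply/hasPn => -[|x p]; rewrite mem_walks//= andbC => /andP[// _ _].
  apply/negP => /andP[/and3P[_ _ /= /andP[]]]; lia.
have g'g u : g u = - g' u by rewrite gg' opprK.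
have step' u w : e u w -> g' w <= g' u + c%:Z.
  by rewrite e_sym => /step; rewrite !gg'; lia.
rewrite big_ord_recr /= mulrDr mulr1 mulrDl.
set C := \prod_(j < s) _ in IH *.
have C0 : 0 <= C.
  by apply: prodr_ge0 => j _; rewrite addr_ge0 // mulr_ge0 // exprn_ge0 // ltW.
have := half_space_count_step s v n gg'; rewrite -(ler_nat R) natrD.
move=> /le_trans; apply; apply: lerD; first exact: IH gg' step bb bb'.
pose W := K * th ^+ s.
have -> : C * (A * th ^+ s) * y ^+ n = (1 - th)^-1 * (W * C * y ^+ n).
  have -> : A * th ^+ s = (1 - th)^-1 * W by rewrite /W mulrAC mulrC.
  by rewrite (mulrCA C) (mulrC C W) !mulrA.
apply: (size_allpairs_le _ (c := fun m => th ^+ m * (W * C * y ^+ n))).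
  move=> m; rewrite mem_iota add0n ltnS => /= mn.
  apply: (size_allpairs_le _ (c := fun=> C * y ^+ (n - m))).
    by move=> p1 _; exact: IH g'g step' bb' bb.
  rewrite big_const_seq count_predT iter_addr_0 -mulr_natl.
  apply: le_trans (ler_wpM2r _ (bridge_span_count s v m step bb)) _.
    by rewrite mulr_ge0 ?exprn_ge0 ?(ltW y0).
  by rewrite mulrACA -exprD subnKC// -!mulrA.
rewrite -mulr_suml ler_wpM2r ?sum_geometric_le//.
by rewrite !mulr_ge0 ?exprn_ge0 ?(ltW K0) ?(ltW th0) ?(ltW y0).
Qed.

(** An n-step walk has span at most c * n, and the products of
    [half_space_span_count] are bounded uniformly in the span. *)
Lemma half_space_count (g g' : V -> int) v n :
  (forall u, g' u = - g u) ->
  (forall u w, e u w -> g w <= g u + c%:Z) -> bridges_bounded g ->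
  bridges_bounded g' ->
  (size (walks_with e (half_space_walk e g v) v n))%:R
    <= expR (A / (1 - th)) * y ^+ n.
Proof.
move=> gg' step bb bb'.
apply: (@le_trans _ _ (\prod_(j < c * n) (1 + A * th ^+ j) * y ^+ n)).
  apply: le_trans (half_space_span_count (c * n) v n gg' step bb bb').
  rewrite ler_nat; apply: uniq_leq_size; first exact: uniq_walks_with.
  move=> p; rewrite !mem_walks_with// => /and3P[hp pp /eqP sp].
  rewrite /half_space_walk_span hp pp sp eqxx !andbT; apply/allP => u up.
  by have := path_height_le step pp (y := u); rewrite inE up orbT sp; apply.
rewrite ler_wpM2r ?exprn_ge0 ?(ltW y0)// prod_geometric_le//.
by rewrite mulr_ge0 ?invr_ge0 ?subr_ge0 ?(ltW K0) ?(ltW th1).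
Qed.

End Rates.
End HammersleyWelsh.

Section SawGrowth.
Variables (V : choiceType) (e : rel V) (h : V -> int) (R : realType) (c : nat).
Hypotheses (e_sym : symmetric e) (e_lf : locally_finite e)
  (step : forall u w, e u w -> (h w <= h u + c%:Z)%R)
  (lower : forall v, exists2 u, e v u & (h u < h v)%R)
  (few_ends : forall tau : R, (1 < tau)%R -> exists2 G : R, (0 < G)%R &
     forall v n, ((size (walk_ends e v n))%:R <= G * tau ^+ n)%R).
Local Open Scope ring_scope.

Lemma reversed_walk u v p : path e v p -> e (last v p) u ->
  [/\ path e u (rev (v :: p)), u \in walk_ends e v (size p).+1
    & size (rev (v :: p)) = (size p).+1].
Proof.
move=> pp zu; split; last by rewrite size_rev.
  rewrite lastI rev_rcons /= e_sym zu /= rev_path.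
  by rewrite (@eq_path _ _ e)// => x y; exact: e_sym.
have pr : path e v (rcons p u) by rewrite rcons_path pp.
by have := mem_walk_ends e_lf pr; rewrite last_rcons size_rcons.
Qed.

(** Reversing a downward bridge from v and prepending a vertex u lower than its
    end gives an upward bridge from u to v with one more step; prepending is
    needed because the end of a bridge need not be its only extremal vertex.
    The vertex u is one of the ends of walks from v, which accounts for the
    first factor. *)
Lemma downward_bridge_count (G K tau t : R) v n :
  0 < G -> 0 < tau ->
  (forall v n, (size (walk_ends e v n))%:R <= G * tau ^+ n) ->
  (forall v n, (size (walks_with e (bridge e h v) v n))%:R <= K * t ^+ n) ->
  (size (walks_with e (bridge e (fun y => - h y) v) v n))%:R
    <= (G * tau ^+ n.+1) * (K * t ^+ n.+1).
Proof.
move=> G0 tau0 ends bb; set h' := fun y => _.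
pose L := [seq behead (rev r) | z <- walk_ends e v n.+1,
                                r <- walks_with e (bridge e h z) z n.+1].
have : (size (walks_with e (bridge e h' v) v n) <= size L)%N.
  apply: uniq_leq_size; first exact: uniq_walks_with.
  move=> p; rewrite mem_walks_with// => /and3P[bp pp /eqP sp].
  have [u zu hu] := lower (last v p).
  have [pr ur sr] := reversed_walk pp zu.
  apply/allpairsPdep; exists u, (rev (v :: p)).
  rewrite -sp; split=> //; last by rewrite revK.
  rewrite mem_walks_with// pr sr eqxx !andbT.
  have ge_last y : y \in v :: p -> h u < h y.
    by move=> /(bridge_le_last bp); rewrite /h'; lia.
  apply: bridgeP => //.
    rewrite /= rev_uniq (bridge_uniq bp) mem_rev andbT.
    by apply/negP => /ge_last; rewrite ltxx.
  move=> y; rewrite mem_rev => yp; split; first exact: ge_last.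
  rewrite rev_cons last_rcons.
  move: yp; rewrite inE => /predU1P[-> //|/(bridge_gt bp)]; rewrite /h'; lia.
rewrite -(ler_nat R) => /le_trans; apply.
apply: (size_allpairs_le _ (c := fun=> K * t ^+ n.+1)) => [u _|]; first exact: bb.
rewrite big_const_seq count_predT iter_addr_0 -mulr_natl ler_wpM2r ?ends//.
by apply: le_trans (bb v n.+1).
Qed.

Lemma last_minimum v p : exists p1 p2, [/\ p = p1 ++ p2,
  forall y, y \in v :: p1 -> h (last v p1) <= h y
  & forall y, y \in p2 -> h (last v p1) < h y].
Proof.
elim: p v => [|x p IH] v.
  by exists [::], [::]; split=> // y; rewrite inE => /eqP ->.
have [p1 [p2 [-> le1 lt2]]] := IH x.
have [le_v|lt_v] := leP (h (last x p1)) (h v).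
  exists (x :: p1), p2; split=> // y; rewrite inE => /predU1P[->//|]; exact: le1.
exists [::], (x :: p1 ++ p2); split=> // y; first by rewrite inE => /eqP ->.
rewrite -cat_cons mem_cat => /orP[/le1|/lt2/ltW]; exact: lt_le_trans.
Qed.

(** Cut a self-avoiding walk at its last lowest vertex: the second part is a
    half-space walk, and so is the reversal of the first part once a vertex u
    lower than the cut is prepended. *)
Lemma saw_count_split v n :
  (size (walks_with e (fun p => uniq (v :: p)) v n) <=
   size [seq q | m <- iota 0 n.+1, q <- [seq r | u <- walk_ends e v m.+1,
     r <- [seq behead (rev r1) ++ p2 |
       r1 <- walks_with e (half_space_walk e h u) u m.+1,
       p2 <- walks_with e (half_space_walk e h (last v (behead (rev r1))))
         (last v (behead (rev r1))) (n - m)%N]]])%N.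
Proof.
apply: uniq_leq_size; first exact: uniq_walks_with.
move=> p; rewrite mem_walks_with// => /and3P[up pp /eqP sp].
have [p1 [p2 [pE le1 lt2]]] := last_minimum v p.
have /andP[pp1 pp2] : path e v p1 && path e (last v p1) p2.
  by rewrite -cat_path -pE.
have [u zu hu] := lower (last v p1).
have [pr ur sr] := reversed_walk pp1 zu.
have rK : behead (rev (rev (v :: p1))) = p1 by rewrite revK.
move: (up); rewrite pE -cat_cons cat_uniq => /and3P[up1 disj up2].
apply/allpairsPdep; exists (size p1), p; split=> //.
  by rewrite mem_iota /= add0n ltnS -sp pE size_cat leq_addr.
apply/allpairsPdep; exists u, p; split=> //.
apply/allpairsPdep; exists (rev (v :: p1)), p2; rewrite rK; split=> //.
  rewrite mem_walks_with// pr sr eqxx !andbT /half_space_walk pr /=.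
  rewrite rev_uniq up1 mem_rev andbT; apply/andP; split.
    by apply/negP => /le1; rewrite leNgt hu.
  by apply/allP => y; rewrite mem_rev => /le1; exact: lt_le_trans.
rewrite mem_walks_with// pp2 -sp pE size_cat addKn eqxx !andbT.
rewrite /half_space_walk pp2 /= up2 andbT; apply/andP; split.
  by apply/negP => /lt2; rewrite ltxx.
by apply/allP => y /lt2.
Qed.

(** The Hammersley--Welsh bound.  The gap between t and y is split into powers
    of th: one pays for the starting points of downward bridges, c.+1 for
    the half-space bound, and two for the sum over cuts and over the vertex u of
    [saw_count_split]. *)
Lemma saw_count_le (K t y : R) : 0 < K -> 0 < t -> t < y ->
  (forall v n, (size (walks_with e (bridge e h v) v n))%:R <= K * t ^+ n) ->
  exists2 C : R, 0 < C & forall v n,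
    (size (walks_with e (fun p => uniq (v :: p)) v n))%:R <= C * y ^+ n.
Proof.
move=> K0 t0 ty bb.
have [th [th0 th1 t_le]] := exists_root_between (c.+1 + 3) t0 ty.
pose tau := th^-1; have tau1 : 1 < tau by rewrite invf_gt1.
have tau0 : 0 < tau by rewrite invr_gt0.
have [G G0 ends] := few_ends tau1.
have [L L0 lin] := linear_le_exponential tau1.
pose t1 := tau * t; have t10 : 0 < t1 by rewrite mulr_gt0.
pose y1 := th ^+ 2 * y; have y0 : 0 < y by exact: lt_trans ty.
have y10 : 0 < y1 by rewrite mulr_gt0 ?exprn_gt0.
have t1_le : t1 <= th ^+ c.+1 * y1.
  rewrite /t1 /tau ler_pdivrMl// mulrCA; apply: le_trans t_le _.
  by rewrite /y1 (mulrA th) -exprS exprD -(mulrA (th ^+ c.+1)).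
pose K1 := K + G * tau * (K * t); have K10 : 0 < K1.
  by rewrite addr_gt0 ?mulr_gt0.
have up v n : (size (walks_with e (bridge e h v) v n))%:R <= K1 * t1 ^+ n.
  apply: le_trans (bb v n) _; apply: ler_pM; rewrite ?exprn_ge0 ?(ltW K0) ?(ltW t0)//.
    by rewrite lerDl !mulr_ge0// ltW.
  by rewrite lerXn2r ?nnegrE ?(ltW t0) ?(ltW t10)// ler_peMl ?(ltW t0) ?(ltW tau1).
have down v n :
    (size (walks_with e (bridge e (fun y => - h y) v) v n))%:R <= K1 * t1 ^+ n.
  apply: le_trans (downward_bridge_count v n G0 tau0 ends bb) _.
  rewrite [leLHS](_ : _ = G * tau * (K * t) * t1 ^+ n).
    by rewrite ler_wpM2r ?exprn_ge0 ?(ltW t10)// lerDr ltW.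
  by rewrite !exprS exprMn (mulrA G) (mulrA K) mulrACA.
have [C C0 hs] : exists2 C : R, 0 < C & forall v n,
    (size (walks_with e (half_space_walk e h v) v n))%:R <= C * y1 ^+ n.
  exists (expR (K1 / (1 - th) / (1 - th))); first exact: expR_gt0.
  move=> v n; apply: (half_space_count e_sym e_lf K10 t10 y10 th0 th1 t1_le v n
    (g' := fun y => - h y)) => //.
exists (G * C * C * y1 * tau * L); first by rewrite !mulr_gt0.
move=> v n; have := saw_count_split v n; rewrite -(ler_nat R) => /le_trans; apply.
pose T := (G * tau ^+ n.+1) * (C * C * y1 ^+ n.+1).
apply: (size_allpairs_le _ (c := fun=> T)) => [m|].
  rewrite mem_iota add0n ltnS => /= mn.
  apply: (size_allpairs_le _ (c := fun=> C * C * y1 ^+ n.+1)) => [u _|].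
    apply: (size_allpairs_le _ (c := fun=> C * y1 ^+ (n - m))) => [r _|].
      exact: hs.
    rewrite big_const_seq count_predT iter_addr_0 -mulr_natl.
    apply: le_trans (ler_wpM2r _ (hs u m.+1)) _.
      by rewrite mulr_ge0 ?exprn_ge0 ?(ltW C0) ?(ltW y10).
    by rewrite mulrACA -exprD addSn subnKC.
  rewrite big_const_seq count_predT iter_addr_0 -mulr_natl.
  rewrite ler_wpM2r ?mulr_ge0 ?exprn_ge0 ?(ltW C0) ?(ltW y10)//.
  apply: le_trans (ends v m.+1) _; rewrite ler_wpM2l ?(ltW G0)//.
  by rewrite ler_weXn2l// ltW.
rewrite big_const_seq count_predT iter_addr_0 size_iota -mulr_natl.
apply: le_trans (ler_wpM2r _ (lin n)) _.
  by rewrite !mulr_ge0 ?exprn_ge0// ltW.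
rewrite [leLHS](_ : _ = G * C * C * y1 * tau * L * (tau * tau * y1) ^+ n).
  apply: ler_wpM2l; first by rewrite !mulr_ge0// ltW.
  by rewrite /y1 mulrA -expr2 /tau -exprMn mulVf ?gt_eqF// expr1n mul1r.
rewrite /T !exprS !exprMn.
set a := tau ^+ n; set b := y1 ^+ n.
by rewrite [LHS](AC (2*((1*2)*(2*2))) ((3*6*7*8*4*1)*(2*5*9))).
Qed.

End SawGrowth.

(** * Bridges between prescribed orbits *)

Section Connectors.
Variables (V : choiceType) (e : rel V) (o : V) (h : V -> int)
  (H : set (V -> V)).
Hypotheses (e_sym : symmetric e) (e_lf : locally_finite e)
  (e_conn : graph_connected e) (ghf : graph_height_function e o h H).
Local Open Scope ring_scope.

Lemma lower_neighbour v : exists2 u, e v u & h u < h v.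
Proof. by case: ghf => _ _ _ _ /(_ v)[u [w [vu _ hu _]]]; exists u. Qed.

Lemma upper_neighbour v : exists2 u, e v u & h v < h u.
Proof. by case: ghf => _ _ _ _ /(_ v)[u [w [_ vw _ hw]]]; exists w. Qed.

(** Walks of strictly increasing heights exist in both directions from every
    vertex; they serve as the two ends of connecting bridges. *)
Definition ascending u p := path (fun a b => e a b && (h a < h b)) u p.

Lemma ascending_path u p : ascending u p -> path e u p.
Proof. by apply: sub_path => x y /andP[]. Qed.

Lemma ascending_gt u p y : ascending u p -> y \in p -> h u < h y.
Proof.
elim: p u => //= x p IH u /andP[/andP[_ ux] /IH{}IH].
by rewrite inE => /predU1P[->//|/IH]; exact: lt_trans.
Qed.

Lemma ascending_le_last u p y :
  ascending u p -> y \in u :: p -> h y <= h (last u p).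
Proof.
elim: p u y => [|x p IH] u y /=; first by rewrite inE => _ /eqP ->.
move=> /andP[/andP[_ ux] ap]; rewrite inE => /predU1P[->|]; last exact: IH.
by apply: le_trans (IH x x ap (mem_head _ _)); exact: ltW.
Qed.

Lemma ascending_rise u p : ascending u p -> h u + (size p)%:Z <= h (last u p).
Proof.
elim: p u => [|x p IH] u /=; first by rewrite addr0.
move=> /andP[/andP[_ ux] /IH]; lia.
Qed.

Lemma ascending_uniq u p : ascending u p -> uniq (u :: p).
Proof.
elim: p u => // x p IH u asc; have /andP[/andP[_ ux] ap] := asc.
rewrite cons_uniq (IH _ ap) andbT.
by apply/negP => /(ascending_gt asc); rewrite ltxx.
Qed.

Lemma ascending_bridge u p : ascending u p -> bridge e h u p.
Proof.
move=> asc; apply: bridgeP (ascending_path asc) (ascending_uniq asc) _ => y yp.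
by rewrite (ascending_gt asc yp) (ascending_le_last asc)// inE yp orbT.
Qed.

Lemma ascending_from u k : exists2 p, ascending u p & size p = k.
Proof.
elim: k u => [|k IH] u; first by exists [::].
have [x ux hx] := upper_neighbour u; have [p ap sp] := IH x.
by exists (x :: p); rewrite /= ?sp// ux hx.
Qed.

Lemma ascending_to v k : exists u p,
  [/\ ascending u p, last u p = v & size p = k].
Proof.
elim: k v => [|k IH] v; first by exists v, [::].
have [x vx hx] := lower_neighbour v; have [u [p [ap lp sp]]] := IH x.
exists u, (rcons p v); split; [|by rewrite last_rcons|by rewrite size_rcons sp].
by rewrite /ascending rcons_path -/(ascending u p) ap lp e_sym vx.
Qed.

Lemma act_lt f u v : H f -> (h (f u) < h (f v)) = (h u < h v).
Proof.
by move=> Hf; rewrite -subr_gt0 (act_height ghf _ _ Hf) subr_gt0.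
Qed.

Lemma act_le f u v : H f -> (h (f u) <= h (f v)) = (h u <= h v).
Proof. by move=> Hf; rewrite !leNgt act_lt. Qed.

Lemma act_bridge f v p : H f ->
  bridge e h (f v) [seq f y | y <- p] = bridge e h v p.
Proof.
move=> Hf; rewrite /bridge /half_space_walk (act_path ghf)// -map_cons.
rewrite (map_inj_uniq (act_inj ghf Hf)) !all_map last_map.
congr (_ && _); last by apply: eq_all => y /=; rewrite act_le.
by congr [&& _, _ & _]; apply: eq_all => y /=; rewrite act_lt.
Qed.

Lemma act_ascending f v p : H f ->
  ascending (f v) [seq f y | y <- p] = ascending v p.
Proof.
move=> Hf; elim: p v => //= x p IH v.
by rewrite IH (act_edge ghf)// act_lt.
Qed.

Lemma path_heights (c : nat) u p y : (forall u w, e u w -> h w <= h u + c%:Z) ->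
  path e u p -> y \in u :: p ->
  [/\ h y <= h u + (c * size p)%:Z, h u <= h y + (c * size p)%:Z,
      h y <= h (last u p) + (c * size p)%:Z
    & h (last u p) <= h y + (c * size p)%:Z].
Proof.
move=> step; elim: p u y => [|x p IH] u y /=.
  by rewrite inE => _ /eqP ->; split; lia.
move=> /andP[ux pp]; have := step _ _ ux.
have : h u <= h x + c%:Z by apply: step; rewrite e_sym.
rewrite mulnS PoszD; move: (c * size p)%N IH => a IH s1 s2.
rewrite inE => /predU1P[->|/(IH _ _ pp)[]]; last by move=> *; split; lia.
by have [] := IH _ _ pp (mem_head _ _); split; lia.
Qed.

(** Climb m steps from u, walk to a translate f w within distance D, where w
    is the foot of an m-step climb to v, and climb to f v.  As m exceeds the height
    variation c * D of the middle part, the heights stay above h u and below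
    h (f v), and removing loops preserves this. *)
Lemma bridge_connector (k : nat) : exists L : nat, forall u v, exists f p,
  [/\ H f, bridge e h u p, last u p = f v, (size p <= L)%N
    & h u + k%:Z <= h (f v)].
Proof.
have [c step] := height_step_bound e_lf ghf.
have [D dist] := orbit_distance_bound e_conn ghf.
(* each climb outweighs the height variation of the middle part, and one of
   them also supplies the required rise k *)
pose m := ((c * D) + k).+1; exists (m + (D + m))%N => u v.
have [p1 a1 s1] := ascending_from u m.
have [w [p3 [a3 l3 s3]]] := ascending_to v m.
have [f Hf [p2 [pp2 l2 s2]]] := dist (last u p1) w.
pose p3' := [seq f y | y <- p3].
have a3' : ascending (f w) p3' by rewrite act_ascending.
have l3' : last (f w) p3' = f v by rewrite last_map l3.
have s3' : size p3' = m by rewrite size_map.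
pose W := p1 ++ p2 ++ p3'.
have pW : path e u W.
  by rewrite !cat_path (ascending_path a1) pp2 l2 (ascending_path a3').
have lW : last u W = f v by rewrite !last_cat l2.
have sW : (size W <= m + (D + m))%N.
  by rewrite !size_cat s1 s3' leq_add2l leq_add2r.
have cD : (c * size p2 <= c * D)%N by rewrite leq_mul2l s2 orbT.
have r1 := ascending_rise a1; have r3 := ascending_rise a3'.
rewrite s1 in r1; rewrite s3' l3' in r3.
have hp2 y : y \in last u p1 :: p2 ->
    h (last u p1) <= h y + (c * D)%:Z /\ h y <= h (f w) + (c * D)%:Z.
  by move=> /(path_heights step pp2)[]; rewrite l2; lia.
have [j1 j2] := hp2 _ (mem_last _ p2); rewrite l2 in j1 j2.
have [j3 j4] := hp2 _ (mem_head _ p2).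
have hW y : y \in W -> h u < h y /\ h y <= h (f v).
  rewrite !mem_cat => /or3P[yp|yp|yp].
  - have := ascending_gt a1 yp; have := @ascending_le_last _ _ y a1.
    by rewrite inE yp orbT => /(_ isT); rewrite /m in r1 r3 *; lia.
  - have := hp2 y; rewrite inE yp orbT => /(_ isT) []; rewrite /m in r1 r3 *; lia.
  - have := ascending_gt a3' yp; have := @ascending_le_last _ _ y a3'.
    by rewrite inE yp orbT l3' => /(_ isT); rewrite /m in r1 r3 *; lia.
have rise : h u + k%:Z <= h (f v) by rewrite /m in r1 r3 *; lia.
exists f; move: lW; case/shortenP: pW => q pq uq sub lq; exists q; split=> //.
- by apply: bridgeP => // y /sub /hW; rewrite lq.
- by apply: leq_trans sW; apply: uniq_leq_size => //; case/andP: uq.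
Qed.

End Connectors.

Section AnchoredBridges.
Variables (V : choiceType) (e : rel V) (o : V) (h : V -> int)
  (H : set (V -> V)) (R : realType).
Hypotheses (e_sym : symmetric e) (e_lf : locally_finite e)
  (e_conn : graph_connected e) (ghf : graph_height_function e o h H)
  (sub : subexponential_growth R e o).
Local Open Scope ring_scope.

(** Sub-exponential growth in the form in which it is used, uniformly over the
    starting vertex. *)
Lemma few_walk_ends (tau : R) : 1 < tau -> exists2 G : R, 0 < G &
  forall v n, (size (walk_ends e v n))%:R <= G * tau ^+ n.
Proof.
move=> tau1; have [G G0 le_G] := subexponential_bound tau1 sub.
have [D le_D] := size_walk_ends_le e_sym e_lf e_conn ghf.
have tau0 : 0 < tau by apply: lt_trans tau1.
exists (G * tau ^+ D); first by rewrite mulr_gt0 ?exprn_gt0.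
move=> v n; apply: (@le_trans _ _ (growth e o (n + D))%:R).
  by rewrite ler_nat.
by apply: le_trans (le_G _) _; rewrite exprD mulrAC mulrA.
Qed.

Definition anchored_bridges (f : V -> V) n :=
  walks_with e (fun p => bridge e h o p && (last o p == f o)) o n.

Lemma anchored_bridgesP f n p : reflect
  [/\ bridge e h o p, last o p = f o & size p = n] (p \in anchored_bridges f n).
Proof.
rewrite mem_walks_with//; apply: (iffP and3P) => [[/andP[bp /eqP lp] _ /eqP sp]|].
  by [].
by move=> [bp -> ->]; rewrite bp !eqxx (bridge_path bp).
Qed.

Definition bridges_grow_slower (t : R) := exists2 K : R, 0 < K &
  forall v n, (size (walks_with e (bridge e h v) v n))%:R <= K * t ^+ n.

Lemma bridges_le_exponential : exists2 D : R, 1 <= D &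
  forall v n, (size (walks_with e (bridge e h v) v n))%:R <= D ^+ n.
Proof.
have [D le_D] := neighbours_bound e_lf ghf; exists D.+1%:R.
  by rewrite ler1n.
move=> v n; rewrite -natrX ler_nat size_filter.
apply: leq_trans (count_size _ _) _; apply: size_walks_le => u.
exact: leqW.
Qed.

(** If bridges are not bounded by a multiple of t^n, there is a vertex v with
    very many bridges of some length n.  Fix their most popular end z
    at the cost of a factor bounded by a multiple of (t / t')^n, and add connecting
    bridges from o to the orbit of v and from that of z to the orbit of o.  The
    second connection also provides the prescribed height k. *)
Lemma many_anchored_bridges (t t' : R) (k n0 : nat) : 0 < t' -> t' < t ->
  ~ bridges_grow_slower t ->
  exists m f, [/\ H f, (n0 <= m)%N, k%:Z <= h (f o)
    & t' ^+ m <= (size (anchored_bridges f m))%:R].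
Proof.
move=> t'0 tt' fast; have t0 : 0 < t by apply: lt_trans tt'.
have [L conn] := bridge_connector e_sym e_lf e_conn ghf k.
have [D D1 le_D] := bridges_le_exponential.
have tau1 : 1 < t / t' by rewrite ltr_pdivlMr ?mul1r.
have [G G0 le_G] := few_walk_ends tau1.
pose M := (1 + t') ^+ (L + L).
have M1 : 1 <= 1 + t' by rewrite lerDl ltW.
(* N rules out the lengths below n0, and M pays for the connecting bridges *)
pose N := D ^+ n0 * (1 + t^-1) ^+ n0.
have N0 : 0 <= N.
  by rewrite mulr_ge0 ?exprn_ge0 ?addr_ge0 ?invr_ge0 ?(ltW t0)// (le_trans ler01).
pose K := G * M + N.
have K0 : 0 < K by rewrite ltr_wpDr// mulr_gt0// exprn_gt0// (lt_le_trans ltr01).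
have [v [n big]] : exists v n, K * t ^+ n < (size (walks_with e (bridge e h v) v n))%:R.
  apply: contrapT => nbig; apply: fast; exists K => // v n.
  by rewrite leNgt; apply/negP => big; apply: nbig; exists v, n.
have n0n : (n0 <= n)%N.
  rewrite leqNgt; apply/negP => nn0; have := lt_le_trans big (le_D v n).
  apply/negP; rewrite -leNgt.
  apply: (@le_trans _ _ (N * t ^+ n)); last first.
    rewrite ler_wpM2r ?exprn_ge0 ?(ltW t0)// lerDr ltW// mulr_gt0//.
    by rewrite exprn_gt0// (lt_le_trans ltr01).
  apply: (@le_trans _ _ (D ^+ n * (1 + t^-1) ^+ n * t ^+ n)).
    rewrite -mulrA -exprMn mulrDl mul1r mulVf ?gt_eqF// ler_peMr//.
      by rewrite exprn_ge0// (le_trans ler01).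
    by rewrite exprn_ege1// lerDr ltW.
  rewrite ler_wpM2r ?exprn_ge0 ?(ltW t0)//.
  have t1 : 1 <= 1 + t^-1 by rewrite lerDl invr_ge0 ltW.
  apply: ler_pM; rewrite ?exprn_ge0 ?(le_trans ler01)//.
    by rewrite ler_weXn2l// ltnW.
  by rewrite ler_weXn2l// ltnW.
set B := walks_with e (bridge e h v) v n in big.
have uB : uniq B by exact: uniq_walks_with.
have B0 : (0 < size B)%N.
  rewrite -(ltr_nat R); apply: le_lt_trans big.
  by rewrite mulr_ge0 ?exprn_ge0 ?(ltW K0) ?(ltW t0).
have [z _ many] : exists2 z, z \in walk_ends e v n &
    (size B <= size (walk_ends e v n) * count (fun p => last v p == z) B)%N.
  apply: (popular_value (f := last v)) => // p.
  rewrite mem_walks_with// => /and3P[_ pp /eqP <-].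
  exact: mem_walk_ends.
have [f [q1 [Hf b1 l1 s1 _]]] := conn o v.
have [g [q2 [Hg b2 l2 s2 rise]]] := conn (f z) o.
exists (size q1 + (n + size q2))%N, g; split=> //.
- by rewrite addnCA (leq_trans n0n)// leq_addr.
- apply: le_trans rise; rewrite lerDr.
  have [p pB /eqP lp] : exists2 p, p \in B & last v p == z.
    apply/hasP; rewrite has_count lt0n; apply: contraTneq many => ->.
    by rewrite muln0 -ltnNge.
  have bp : bridge e h v p by move: pB; rewrite mem_walks_with// => /andP[].
  have le1 := bridge_le_last b1 (mem_head _ _).
  have [h0 _ _ _ _] := ghf; rewrite h0 l1 in le1; apply: le_trans le1 _.
  by rewrite (act_le ghf)// -lp (bridge_le_last bp)// mem_head.
have : (count (fun p => last v p == z) B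
    <= size (anchored_bridges g (size q1 + (n + size q2))))%N.
  rewrite -size_filter.
  rewrite -(size_map (fun p => q1 ++ [seq f y | y <- p] ++ q2)).
  apply: uniq_leq_size.
    rewrite map_inj_uniq; first exact: filter_uniq.
    move=> p p' /eqP.
    rewrite eqseq_cat// eqxx /= => pp'.
    have sz : size p = size p'.
      by have := congr1 size (eqP pp'); rewrite !size_cat !size_map => /addIn.
    move: pp'; rewrite eqseq_cat ?size_map// => /andP[/eqP pp' _].
    exact: (inj_map (act_inj ghf Hf)) pp'.
  move=> r /mapP[p]; rewrite mem_filter mem_walks_with//.
  move=> /and4P[/eqP lp bp _ /eqP sp] ->; apply/anchored_bridgesP.
  rewrite !size_cat !last_cat size_map l1 last_map lp sp l2; split=> //.
  apply: bridge_cat => //; rewrite l1; apply: bridge_cat.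
    by rewrite (act_bridge ghf).
  by rewrite last_map lp.
rewrite -(ler_nat R) => /(le_trans _); apply.
move: many; set N' := count _ B => many.
have cnt : M * t' ^+ n <= N'%:R.
  have : G * M * t ^+ n <= G * (t / t') ^+ n * N'%:R.
    apply: (@le_trans _ _ ((size (walk_ends e v n))%:R * N'%:R)).
      rewrite -natrM; apply: le_trans (ltW (lt_le_trans big _)).
        by rewrite ler_wpM2r ?exprn_ge0 ?(ltW t0)// lerDl.
      by rewrite ler_nat.
    by rewrite ler_wpM2r.
  rewrite -!mulrA ler_pM2l// expr_div_n mulrC -mulrA ler_pM2l ?exprn_gt0//.
  by rewrite ler_pdivlMl ?exprn_gt0// mulrC.
apply: le_trans cnt; rewrite addnCA exprD mulrC ler_wpM2r ?exprn_ge0 ?(ltW t'0)//.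
apply: (@le_trans _ _ ((1 + t') ^+ (size q1 + size q2))).
  by rewrite lerXn2r ?nnegrE ?addr_ge0 ?(ltW t'0)// lerDr.
by rewrite ler_weXn2l// leq_add.
Qed.

(** Concatenate q bridges from o to f o, the i-th moved by the i-th power of f,
    and climb r further steps. *)
Lemma anchored_bridges_power f m q r : H f ->
  (size (anchored_bridges f m) ^ q
    <= size (walks_with e (bridge e h o) o (q * m + r)))%N.
Proof.
move=> Hf; elim: q => [|q IH].
  have [p asc sp] := ascending_from ghf o r.
  rewrite expn0 mul0n add0n; case E : (walks_with _ _ _ _) => //.
  have : p \in walks_with e (bridge e h o) o r.
    by rewrite mem_walks_with// (ascending_bridge asc) (ascending_path asc) sp eqxx.
  by rewrite E.
rewrite expnS; apply: leq_trans (leq_mul (leqnn _) IH) _.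
rewrite -(size_allpairs (fun p p' => p ++ [seq f y | y <- p'])).
apply: uniq_leq_size.
  apply: allpairs_uniq; rewrite ?uniq_walks_with// => -[p p'] [r1 r2].
  move=> /allpairsP[[a b] /= [/anchored_bridgesP[_ _ sa] _ [-> ->]]].
  move=> /allpairsP[[c d] /= [/anchored_bridgesP[_ _ sc] _ [-> ->]]] /= /eqP.
  rewrite eqseq_cat ?sa ?sc// => /andP[/eqP -> /eqP].
  by move=> /(inj_map (act_inj ghf Hf)) ->.
move=> w /allpairsP[[p p']] /= [/anchored_bridgesP[bp lp sp]].
rewrite mem_walks_with// => /and3P[bp' _ /eqP sp'] ->.
have b : bridge e h o (p ++ [seq f y | y <- p']).
  by apply: bridge_cat => //; rewrite lp (act_bridge ghf).
by rewrite mem_walks_with// b (bridge_path b) size_cat size_map sp sp' mulSn addnA eqxx.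
Qed.

(** Writing n = q * m + r, the bound at the single length m propagates to all
    lengths through [anchored_bridges_power]. *)
Lemma saw_count_ge (t : R) f m : 0 < t -> (0 < m)%N -> H f ->
  t ^+ m <= (size (anchored_bridges f m))%:R ->
  exists2 c : R, 0 < c & forall n,
    c * t ^+ n <= (size (walks_with e (fun p => uniq (o :: p)) o n))%:R.
Proof.
move=> t0 m0 Hf le_t; have t1 : 0 < 1 + t by rewrite addr_gt0.
exists ((1 + t) ^- m) => [|n]; first by rewrite invr_gt0 exprn_gt0.
apply: (@le_trans _ _ (size (walks_with e (bridge e h o) o n))%:R); last first.
  rewrite ler_nat; apply: uniq_leq_size; first exact: uniq_walks_with.
  move=> p; rewrite !mem_walks_with// => /and3P[bp -> ->].
  by rewrite (bridge_uniq bp).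
rewrite (divn_eq n m); set q := (n %/ m)%N; set r := (n %% m)%N.
apply: (@le_trans _ _ ((size (anchored_bridges f m)) ^ q)%N%:R); last first.
  by rewrite ler_nat anchored_bridges_power.
rewrite natrX exprD mulnC exprM mulrCA -[leRHS]mulr1.
apply: ler_pM.
- by rewrite !exprn_ge0// ltW.
- by rewrite mulr_ge0 ?invr_ge0 ?exprn_ge0// ltW.
- by rewrite lerXn2r ?nnegrE ?exprn_ge0 ?(ltW t0).
rewrite ler_pdivrMl ?exprn_gt0// mulr1; apply: (@le_trans _ _ ((1 + t) ^+ r)).
  by rewrite lerXn2r ?nnegrE ?(ltW t0) ?(ltW t1)// lerDr.
by rewrite ler_weXn2l ?lerDl ?(ltW t0)// ltnW// ltn_pmod.
Qed.

End AnchoredBridges.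

(** * Polygons as cyclic vertex lists *)

Section Polygons.
Variables (V : choiceType) (e : rel V) (o : V).
Hypothesis (e_lf : locally_finite e).

Definition rooted_cycles n :=
  walks_with e (fun q => cycle e (o :: q) && uniq (o :: q)) o n.

Lemma mem_rooted_cycles n q :
  (q \in rooted_cycles n) = [&& cycle e (o :: q), uniq (o :: q) & size q == n].
Proof.
rewrite mem_walks_with// -andbA /= rcons_path.
by case: (path e o q) => //; rewrite ?andbF.
Qed.

Lemma cycle_edges_rot (c : seq V) i : uniq c ->
  cycle_edges (rot i c) = cycle_edges c.
Proof.
move=> uc; apply/fsetP => E; apply/imfsetP/imfsetP => /= -[x xc ->].
  by exists x; [rewrite mem_rot in xc|rewrite next_rot].
by exists x; [rewrite /= mem_rot|rewrite next_rot].
Qed.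

Lemma mem_polygons n E : (2 <= n)%N ->
  polygons e o n.+1 E <->
  E \in undup [seq cycle_edges (o :: q) | q <- rooted_cycles n].
Proof.
move=> n2; rewrite mem_undup; split.
  move=> [_ [c [sc /andP[cc uc] oc ->]]].
  have [i q cE] := rot_to oc; apply/mapP; exists q.
    rewrite mem_rooted_cycles -cE rot_cycle cc rot_uniq uc.
    by rewrite -eqSS -sc -(size_rot i c) cE /=.
  by rewrite -(cycle_edges_rot i uc) cE.
move=> /mapP[q]; rewrite mem_rooted_cycles => /and3P[cc uc /eqP sq] ->.
split=> //; exists (o :: q); rewrite /= sq mem_head; split=> //.
exact/andP.
Qed.

Lemma card_polygonsE n : (2 <= n)%N ->
  set_card (polygons e o n.+1) =
  size (undup [seq cycle_edges (o :: q) | q <- rooted_cycles n]).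
Proof.
by move=> n2; apply: set_cardE (undup_uniq _) _ => E; exact: mem_polygons.
Qed.

Lemma card_polygons_le n : (2 <= n)%N ->
  (set_card (polygons e o n.+1)
    <= size (walks_with e (fun p => uniq (o :: p)) o n))%N.
Proof.
move=> n2; rewrite card_polygonsE//; apply: leq_trans (size_undup _) _.
rewrite size_map; apply: uniq_leq_size; first exact: uniq_walks_with.
move=> q; rewrite mem_rooted_cycles mem_walks_with// => /and3P[+ -> ->].
by rewrite /= rcons_path => /andP[->].
Qed.

Lemma next_nth_uniq (q : seq V) k : uniq (o :: q) -> (k <= size q)%N ->
  next (o :: q) (nth o (o :: q) k) = nth o q k.
Proof. by move=> uq kq; rewrite next_nth mem_nth// index_uniq. Qed.

(** The second vertex fixes the orientation; after that each vertex has exactly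
    one neighbour in the cycle besides its predecessor. *)
Lemma cycle_edges_inj q q' : uniq (o :: q) -> uniq (o :: q') ->
  size q = size q' -> head o q = head o q' ->
  cycle_edges (o :: q) = cycle_edges (o :: q') -> q = q'.
Proof.
move=> uq uq' sq hq eqE; apply: (@eq_from_nth _ o) => // k kq.
suff : forall k, (k <= size q)%N ->
    nth o (o :: q) k = nth o (o :: q') k /\ nth o q k = nth o q' k.
  by move=> /(_ k (ltnW kq))[].
move=> {kq}; elim=> [_|{}k IH kq]; first by rewrite !nth0.
have [IH1 IH2] := IH (ltnW kq); split=> //.
case: (ltngtP k.+1 (size q)) kq => // [kq _|kq _]; last first.
  by rewrite !nth_default -?sq ?kq.
set a := nth o (o :: q) k in IH1; set b := nth o q k in IH2.
set x := nth o q k.+1; set x' := nth o q' k.+1.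
have k1 : (k.+1 <= size q)%N by exact: ltnW.
have k0 : (k <= size q)%N by exact: ltnW.
have bE : b = nth o (o :: q) k.+1 by [].
have bE' : b = nth o (o :: q') k.+1 by [].
have bC' : b \in o :: q' by rewrite bE' mem_nth//= ltnS -sq.
have nb : next (o :: q) b = x by rewrite bE next_nth_uniq.
have na : next (o :: q) a = b by rewrite /a next_nth_uniq.
have nb' : next (o :: q') b = x' by rewrite bE' next_nth_uniq// -sq.
have x'E : x' = nth o (o :: q') k.+2 by [].
have bx' : b != x'.
  by rewrite bE' x'E nth_uniq /= ?ltnS -?sq// neq_ltn ltnSn.
have ax' : a != x'.
  by rewrite IH1 x'E nth_uniq /= ?ltnS -?sq// neq_ltn ltnW.
have : [fset b; x']%fset \in cycle_edges (o :: q').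
  by apply/imfsetP; exists b => //; rewrite nb'.
rewrite -eqE => /imfsetP[y _ /fsetP eqF].
have := eqF b; rewrite in_fset2 eqxx orTb in_fset2 => /esym/orP[/eqP yb|/eqP yb].
  have := eqF x'; rewrite in_fset2 eqxx orbT in_fset2 -yb (negPf (_ : x' != b)) 1?eq_sym//.
  by rewrite nb => /esym/eqP.
have ya : y = a.
  by apply: (can_inj (prev_next uq)); rewrite -yb na.
have := eqF x'; rewrite in_fset2 eqxx orbT in_fset2 -yb ya.
by rewrite eq_sym (negPf ax') eq_sym (negPf bx').
Qed.

(** A polygon through o has two orientations; counting the possible second
    vertices by the degree of o avoids identifying the reversal. *)
Lemma rooted_cycles_le n : (2 <= n)%N ->
  (size (rooted_cycles n) <=
   set_card (polygons e o n.+1) * size (neighbours e o))%N.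
Proof.
move=> n2; rewrite card_polygonsE//.
rewrite -(size_allpairs pair).
apply: (@size_le_code _ _ _ _ (fun q b => cycle_edges (o :: q) = b.1 /\ head o q = b.2)).
- exact: uniq_walks_with.
- move=> q qr; exists (cycle_edges (o :: q), head o q) => //.
  apply: allpairs_f; first by rewrite mem_undup; apply: map_f.
  move: qr; rewrite mem_rooted_cycles mem_neighbours// => /and3P[+ _ /eqP sq].
  by case: q sq => /= [sq|x q _ /andP[]//]; rewrite -sq in n2.
move=> q q' b; rewrite !mem_rooted_cycles => /and3P[_ uq /eqP sq].
move=> /and3P[_ uq' /eqP sq'] _ [e1 h1] [e2 h2].
by apply: cycle_edges_inj; rewrite ?sq ?sq' ?h1 ?h2 ?e1 ?e2.
Qed.

End Polygons.

(** * Closing two bridges into a polygon *)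

Section IntIter.
Variables (T : Type) (f g : T -> T).
Hypotheses (fK : cancel f g) (gK : cancel g f).
Local Open Scope ring_scope.

Definition int_iter (k : int) (x : T) : T :=
  match k with Posz n => iter n f x | Negz n => iter n.+1 g x end.

Lemma int_iterS k x : int_iter (k + 1) x = f (int_iter k x).
Proof.
case: k => [n|[|n]].
- by rewrite (_ : Posz n + 1 = Posz n.+1)//; lia.
- by rewrite (_ : Negz 0 + 1 = Posz 0)//= gK.
- by rewrite (_ : Negz n.+1 + 1 = Negz n)/= ?gK//; lia.
Qed.

Lemma int_iterB1 k x : int_iter (k - 1) x = g (int_iter k x).
Proof. by rewrite -[k in RHS](subrK 1) int_iterS fK. Qed.

Lemma int_iterD k l x : int_iter (k + l) x = int_iter k (int_iter l x).
Proof.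
elim/int_rect: k => [|n IH|n IH]; first by rewrite add0r.
- have -> : n.+1%:Z + l = n%:Z + l + 1 by lia.
  by rewrite int_iterS IH -int_iterS; congr int_iter; lia.
- have -> : - n.+1%:Z + l = - n%:Z + l - 1 by lia.
  by rewrite int_iterB1 IH -int_iterB1; congr int_iter; lia.
Qed.

Lemma int_iterNK k : cancel (int_iter k) (int_iter (- k)).
Proof. by move=> x; rewrite -int_iterD addNr. Qed.

Lemma int_iter_inj k : injective (int_iter k).
Proof. exact: can_inj (int_iterNK k). Qed.

Lemma int_iterSr k x : int_iter (k + 1) x = int_iter k (f x).
Proof. by rewrite int_iterD. Qed.

End IntIter.

(** If some positive power of rho fixed x, the orbit of x would be finite and
    invariant. *)
Lemma translation_free (V : choiceType) (rho : V -> V) m n x :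
  injective rho -> translation rho -> iter m rho x = iter n rho x -> m = n.
Proof.
move=> inj tr; wlog mn : m n / (m <= n)%N.
  by move=> W E; case: (leqP m n) => [/W|/ltnW/W] ->.
have injm : injective (iter m rho) by elim: m {mn} => //= m IH; exact: inj_comp.
rewrite -(subnKC mn) iterD => /injm; set d := (n - m)%N => xd.
case: (posnP d) => [->|d0]; first by rewrite addn0.
exfalso; apply: tr; exists [set` traject rho x d]; split.
- by exists x; rewrite /= -(prednK d0) mem_head.
- exact: finite_seq.
apply/seteqP; split=> y /=.
  move=> [z /= /trajectP[i id ->] <-]; rewrite -iterS; apply/trajectP.
  have [->|ni] := eqVneq i.+1 d; first by exists 0%N.
  by exists i.+1 => //; rewrite ltn_neqAle ni.
move=> /trajectP[[|i] id ->] /=.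
  exists (iter d.-1 rho x); last by rewrite -iterS prednK.
  by apply/trajectP; exists d.-1; rewrite ?prednK.
by exists (iter i rho x) => //; apply/trajectP; exists i => //; exact: ltnW.
Qed.

Section SquareHeight.
Variables (V : choiceType) (e : rel V) (o : V) (h : V -> int)
  (H : set (V -> V)) (rho : V -> V).
Hypotheses (e_sym : symmetric e) (e_lf : locally_finite e)
  (ghf : graph_height_function e o h H) (Hrho : H rho)
  (rho_translation : translation rho) (rho_height : forall v, h (rho v) = h v)
  (rho_central : forall a, H a -> rho \o a = a \o rho).
Variables (c D : nat).
Hypotheses (step : forall u w, e u w -> (h w <= h u + c%:Z)%R)
  (displacement : forall v, exists p,
    [/\ path e v p, last v p = rho v & (size p <= D)%N]).
Variables (f g : V -> V).
Hypotheses (Hf : H f) (Hg : H g) (fK : cancel f g) (gK : cancel g f)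
  (f_high : (((c * D).*2)%:Z < h (f o))%R).
Local Open Scope ring_scope.

(** The bi-infinite path generated by a bridge from o to f o is invariant under
    f; [period] is its gain of height per period. *)
Definition period := h (f o).
Definition fpow := int_iter f g.
Definition rpow m := iter m rho.

Lemma h_root : h o = 0. Proof. by case: ghf. Qed.

Lemma act_iter a n : H a -> H (iter n a).
Proof.
move=> Ha; elim: n => [|n IH]; first exact: (act_id ghf).
exact: (act_comp ghf Ha IH).
Qed.

Lemma fpow_act k : H (fpow k).
Proof. by case: k => n; [exact: act_iter|exact: (act_iter n.+1)]. Qed.

Lemma rpow_act m : H (rpow m). Proof. exact: act_iter. Qed.

Lemma f_height x : h (f x) = h x + period.
Proof. have := act_height ghf o x Hf; rewrite h_root /period; lia. Qed.

Lemma fpow_height k x : h (fpow k x) = h x + k * period.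
Proof.
elim/int_rect: k => [|n IH|n IH]; first by rewrite mul0r addr0.
- have -> : n.+1%:Z = n%:Z + 1 by lia.
  by rewrite /fpow int_iterS// f_height -/(fpow _) IH mulrDl mul1r addrA.
- have -> : - n.+1%:Z = - n%:Z - 1 by lia.
  rewrite /fpow int_iterB1// -/(fpow _) mulrBl mul1r.
  have := f_height (g (fpow (- n%:Z) x)).
  by rewrite addrA gK IH => ->; rewrite addrK.
Qed.

Lemma rpow_height m x : h (rpow m x) = h x.
Proof. by elim: m => //= m IH; rewrite rho_height. Qed.

Lemma rpow_comm m a x : H a -> rpow m (a x) = a (rpow m x).
Proof.
move=> Ha; elim: m => //= m IH; rewrite IH.
by have /(congr1 (fun k => k (rpow m x))) := rho_central Ha.
Qed.

Lemma fpow_inj k : injective (fpow k).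
Proof. exact: int_iter_inj. Qed.

Lemma period_gt0 : 0 < period. Proof. by rewrite /period; lia. Qed.

(** Each period of an f-invariant path occupies its own window of heights
    (k * period, (k + 1) * period], so vertices in distinct periods differ. *)
Lemma same_window k l x y : 0 < h x <= period -> 0 < h y <= period ->
  fpow k x = fpow l y -> k = l /\ x = y.
Proof.
move=> /andP[x0 xs] /andP[y0 ys] E; suff kl : k = l.
  by split=> //; move: E; rewrite kl => /fpow_inj.
have := congr1 h E; rewrite !fpow_height; have := period_gt0; move: x0 xs y0 ys.
move: (h x) (h y) period => a b t; clear; nia.
Qed.

Lemma rpow_eq m m' x : rpow m x = rpow m' x -> m = m'.
Proof. exact: translation_free (act_inj ghf Hrho) rho_translation. Qed.

(** The height determines the power of f, and rho acts freely. *)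
Lemma fpow_rpow_eq k m k' m' x :
  fpow k (rpow m x) = fpow k' (rpow m' x) -> k = k' /\ m = m'.
Proof.
move=> E; suff kk : k = k'.
  by split=> //; move: E; rewrite kk => /fpow_inj /rpow_eq.
have := congr1 h E; rewrite !fpow_height !rpow_height; have := period_gt0.
move: (h x) period => a t; clear; nia.
Qed.

Section Pair.
Variables (n : nat) (p p' : seq V).
Hypotheses (bp : bridge e h o p) (lp : last o p = f o) (sp : size p = n)
  (bp' : bridge e h o p') (lp' : last o p' = f o) (sp' : size p' = n).

Lemma window q y : bridge e h o q -> last o q = f o -> y \in q ->
  0 < h y <= period.
Proof.
move=> bq lq yq; rewrite -h_root (bridge_gt bq yq) /=.
by rewrite /period -lq (bridge_le_last bq)// inE yq orbT.
Qed.

Lemma f_o_last q : last o q = f o -> exists q', q = rcons q' (f o).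
Proof.
case/lastP: q => [/= E|q x]; last by rewrite last_rcons => ->; exists q.
by have := period_gt0; rewrite /period -E h_root.
Qed.

(** Membership of z in the f-invariant bi-infinite path through the image of q
    under T. *)
Definition on_lift (T : V -> V) (q : seq V) (z : V) :=
  exists k y, y \in q /\ z = fpow k (T y).

(** By freeness, each pair of a vertex of p' and a vertex of p is matched by at
    most one power of rho, so the translates of p' by rho^m meet p for finitely
    many m only, m = 0 among them; M + 1 is the first m for which they do
    not. *)
Lemma touching_translate : exists M,
  (exists2 y, y \in p' & rpow M y \in p) /\
  (forall y, y \in p' -> rpow M.+1 y \notin p).
Proof.
pose S m := has (fun y => rpow m y \in p) p'.
have S0 : S 0%N.
  have [[q qE] [q' qE']] := (f_o_last lp, f_o_last lp').
  by apply/hasP; exists (f o); rewrite /= ?qE ?qE' mem_rcons mem_head.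
have ex : exists m, ~~ S m.
  apply: contrapT => nex.
  have allS m : S m by apply/negPn/negP => nS; apply: nex; exists m.
  pose N := (size p' * size p).+1.
  suff : (size (iota 0 N) <= size p' * size p)%N by rewrite size_iota ltnn.
  rewrite -(size_allpairs pair).
  apply: (@size_le_code _ _ _ _ (fun m b => rpow m b.1 = b.2)) (iota_uniq 0 N) _ _.
    move=> m _; have /hasP[y yp' yp] := allS m; exists (y, rpow m y) => //.
    exact: allpairs_f.
  by move=> m m' b _ _ _ <- /esym /rpow_eq.
case: (ex_minnP ex) => -[|M]; first by rewrite S0.
move=> nS minM; exists M; split.
  apply/hasP; rewrite -/(S M); apply: contraT => /minM; by rewrite ltnn.
by move=> y yp'; apply: contra nS => yp; apply/hasP; exists y.
Qed.

(** Two bi-infinite paths can only meet inside a common height window, that is,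
    within one period. *)
Lemma lift_disjoint m z : (forall y, y \in p' -> rpow m y \notin p) ->
  on_lift id p z -> on_lift (rpow m) p' z -> False.
Proof.
move=> dis [k [y [yp ->]]] [l [y' [yp' /= E]]].
have wy' : 0 < h (rpow m y') <= period by rewrite rpow_height (window bp' lp').
have [_ yE] := same_window (window bp lp yp) wy' E.
by move: (dis _ yp'); rewrite -yE yp.
Qed.

Lemma on_lift_fpow T q l z : on_lift T q z -> on_lift T q (fpow l z).
Proof.
by move=> [k [y [yq ->]]]; exists (l + k), y; split=> //; rewrite /fpow int_iterD.
Qed.

Lemma on_lift_f T q z : on_lift T q (f z) <-> on_lift T q z.
Proof.
have fE x : f x = fpow 1 x by [].
split=> [/(on_lift_fpow (-1))|]; last by rewrite fE; exact: on_lift_fpow.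
by rewrite fE /fpow int_iterNK.
Qed.

(** Applying rho once to a meeting point of p and rho^M p' gives a walk of at
    most D steps between the two disjoint bi-infinite paths.  A shortest such
    walk has its inner vertices off both paths and can be moved by a power of f
    so as to start on p itself. *)
Lemma connection : exists m u y q0, [/\
  (forall y, y \in p' -> rpow m y \notin p), u \in p & y \in p'] /\ exists k, [/\
  path e u (rcons q0 (fpow k (rpow m y))), uniq q0, (size q0 < D)%N
  & forall z, z \in q0 -> ~ on_lift id p z /\ ~ on_lift (rpow m) p' z].
Proof.
have [M [[y0 y0p' y0p] dis]] := touching_translate.
pose Q d := exists u w q, [/\ on_lift id p u, on_lift (rpow M.+1) p' w,
  path e u q, last u q = w & size q = d].
have QD : exists2 d, (d <= D)%N & Q d.
  have [q [pq lq sq]] := displacement (rpow M y0); exists (size q) => //.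
  exists (rpow M y0), (rho (rpow M y0)), q; split=> //.
    by exists 0, (rpow M y0).
  by exists 0, y0.
have exQ : exists d, `[< Q d >] by case: QD => d _ Qd; exists d; apply/asboolP.
case: (ex_minnP exQ) => d /asboolP[u [w [q [uP wP pq lq sq]]]] min.
have {}min d' : Q d' -> (d <= d')%N by move=> Qd; apply: min; apply/asboolP.
have dD : (d <= D)%N by case: QD => d' d'D /min; move=> /leq_trans; apply.
wlog up : u w q uP wP pq lq sq / u \in p.
  move=> W; have [k [y [yp uE]]] := uP.
  apply: (W (fpow (- k) u) (fpow (- k) w) [seq fpow (- k) z | z <- q]).
  - exact: on_lift_fpow.
  - exact: on_lift_fpow.
  - by rewrite (act_path ghf)//; exact: fpow_act.
  - by rewrite last_map lq.
  - by rewrite size_map.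
  - by rewrite uE /fpow int_iterNK.
have [k [y [yp' wE]]] := wP.
case/lastP: q => [|q0 x] in pq lq sq *.
  by exfalso; apply: (lift_disjoint dis uP); rewrite -[u]/(last u [::]) lq.
rewrite last_rcons in lq; rewrite lq in pq sq * => {x lq}.
rewrite size_rcons in sq.
exists M.+1, u, y, q0; split=> //; exists k; rewrite -wE; split=> //.
- suff : uniq (rcons q0 w) by rewrite rcons_uniq => /andP[].
  have lw : last u (rcons q0 w) = w by rewrite last_rcons.
  move: pq lw; set q := rcons q0 w => pq.
  case/shortenP: (pq) => q' pq' uq' sub lw.
  have uq'' : uniq q' by case/andP: uq'.
  apply: (leq_size_uniq uq'' sub); rewrite size_rcons sq; apply: min.
  by exists u, w, q'.
- by rewrite sq.
move=> z zq0; case/splitPr: zq0 pq sq => q1 q2.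
rewrite rcons_cat rcons_cons cat_path /= => /and3P[pq1 ez pq2].
rewrite size_cat /= => sq; split=> zP.
  have : Q (size (rcons q2 w)).
    by exists z, w, (rcons q2 w); split=> //; rewrite last_rcons.
  by move/min; rewrite size_rcons -sq ltnNge leq_addl.
have : Q (size (rcons q1 z)).
  by exists u, z, (rcons q1 z); split=> //; rewrite ?last_rcons// rcons_path pq1.
by move/min; rewrite size_rcons -sq ltnS addnS ltnNge leq_addr.
Qed.

Lemma uniq_catP (q1 q2 : seq V) : uniq q1 -> uniq q2 ->
  (forall z, z \in q1 -> z \in q2 -> False) -> uniq (q1 ++ q2).
Proof.
move=> u1 u2 dis; rewrite cat_uniq u1 u2 andbT; apply/hasPn => z z2.
by apply/negP => z1; exact: dis z1 z2.
Qed.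

(** The arc from x to f x of the bi-infinite path generated by q. *)
Lemma arcP q q1 x q2 : bridge e h o q -> last o q = f o -> q = q1 ++ x :: q2 ->
  let t := q2 ++ [seq f z | z <- rcons q1 x] in
  [/\ path e x t, last x t = f x, uniq (x :: t)
    & forall z, z \in x :: t -> on_lift id q z].
Proof.
move=> bq lq qE t.
have [pq1 pq2] : path e o (rcons q1 x) /\ path e x q2.
  by have := bridge_path bq; rewrite qE -cat_rcons cat_path last_rcons => /andP.
have lq2 : last x q2 = f o by rewrite -lq qE last_cat.
have memt z : z \in x :: t ->
    (z \in q) \/ exists2 y, y \in rcons q1 x & z = f y.
  rewrite -cat_cons mem_cat => /orP[zq|/mapP]; last by right.
  by left; rewrite qE mem_cat zq orbT.
have subq y : y \in rcons q1 x -> y \in q.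
  by move=> yq; rewrite qE -cat_rcons mem_cat yq.
split.
- by rewrite cat_path pq2 lq2 (act_path ghf).
- by rewrite last_cat lq2 last_map last_rcons.
- have uq : uniq q by have := bridge_uniq bq; rewrite cons_uniq => /andP[].
  have uq1 : uniq (rcons q1 x).
    by move: uq; rewrite qE -cat_rcons cat_uniq => /andP[].
  have uq2 : uniq (x :: q2) by move: uq; rewrite qE cat_uniq => /and3P[].
  rewrite -cat_cons; apply: uniq_catP => //.
    by rewrite (map_inj_uniq (act_inj ghf Hf)).
  move=> z fyq /mapP[y yq zE]; rewrite {}zE in fyq.
  have wy := window bq lq (subq _ yq).
  have wfy : 0 < h (f y) <= period.
    by apply: (window bq lq); rewrite qE mem_cat fyq orbT.
  by move: wfy; rewrite f_height; move: wy; clear; lia.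
move=> z /memt[zq|[y yq ->]]; first by exists 0, z.
by exists 1, y; split=> //; exact: subq.
Qed.

(** Along the first path from u to f u, across by the image under f of the
    connection q0, back along the second path, and across by q0 reversed. *)
Definition closing_cycle (T : V -> V) p1 u p2 q1 y q2 q0 :=
  (u :: p2 ++ [seq f z | z <- rcons p1 u]) ++ [seq f z | z <- q0] ++
  rev [seq T z | z <- y :: q2 ++ [seq f z | z <- rcons q1 y]] ++ rev q0.

Definition translate k m z := fpow k (rpow m z).

Lemma translate_act k m : H (translate k m).
Proof. exact: (act_comp ghf (fpow_act k) (rpow_act m)). Qed.

Lemma translate_f k m z : translate k m (f z) = f (translate k m z).
Proof. by rewrite /translate rpow_comm// /fpow -int_iterSr// int_iterS. Qed.

(** The four pieces are disjoint: the two paths are, the connections avoid both,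
    and the connection and its image under f are separated in height because the
    period exceeds twice the height variation c * D of the connection.  The
    polygon contains f o, since the first arc covers a whole period. *)
Lemma closing_cycleP k m p1 u p2 q1 y q2 q0 :
  p = p1 ++ u :: p2 -> p' = q1 ++ y :: q2 ->
  (forall z, z \in p' -> rpow m z \notin p) ->
  path e u (rcons q0 (translate k m y)) -> uniq q0 -> (size q0 < D)%N ->
  (forall z, z \in q0 -> ~ on_lift id p z /\ ~ on_lift (rpow m) p' z) ->
  let c := closing_cycle (translate k m) p1 u p2 q1 y q2 q0 in
  [/\ cycle e c, uniq c, f o \in c & size c = (n + n + size q0 + size q0).+2].
Proof.
move=> pE p'E dis pq0 uq0 sq0 off c0.
set w := translate k m y in pq0.
have [/= pa la ua ona] := arcP bp lp pE.
set t1 := p2 ++ _ in pa la ua ona.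
have [/= pb lb ub onb] := arcP bp' lp' p'E.
set t2 := q2 ++ _ in pb lb ub onb.
pose T := translate k m; have HT : H T := translate_act k m.
have pTb : path e w [seq T z | z <- t2] by rewrite /w (act_path ghf).
have lTb : last w [seq T z | z <- t2] = f w by rewrite last_map lb translate_f.
have onTb z : z \in [seq T z | z <- y :: t2] -> on_lift (rpow m) p' z.
  move=> /mapP[x /onb [l [x' [x'p ->]]] ->]; exists (k + l), x'; split=> //.
  by rewrite /T /translate (rpow_comm m x' (fpow_act l)); exact/esym/int_iterD.
have cyc : cycle e c0.
  have cE : c0 = u :: (t1 ++ [seq f z | z <- rcons q0 w] ++
      rev (belast w [seq T z | z <- t2]) ++ rev q0).
    rewrite /c0 /closing_cycle -/t1 -/t2 map_cons -/T -/w [w :: _]lastI lTb.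
    by rewrite rev_rcons map_rcons cat_rcons.
  rewrite cE; clear cE; clearbody c0 t1 t2.
  rewrite [cycle _ _]/= !rcons_cat -rev_cons !cat_path pa la (act_path ghf)//.
  rewrite pq0 /=.
  rewrite last_map last_rcons -lTb last_rev_belast rev_path.
  rewrite (@eq_path _ _ e) ?pTb /=; last by move=> x z; exact: e_sym.
  have -> : rev (u :: q0) = rev (belast u (rcons q0 w)).
    by rewrite belast_rcons.
  rewrite -{1}(last_rcons u q0 w) rev_path.
  by rewrite (@eq_path _ _ e)// => x z; exact: e_sym.
have uc : uniq c0.
  have fq0off z : z \in [seq f z | z <- q0] ->
      ~ on_lift id p z /\ ~ on_lift (rpow m) p' z.
    by move=> /mapP[x /off[n1 n2] ->]; split=> /on_lift_f.
  rewrite /c0 /closing_cycle; apply: uniq_catP; first exact: ua.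
    apply: uniq_catP; first by rewrite (map_inj_uniq (act_inj ghf Hf)).
      apply: uniq_catP; rewrite ?rev_uniq//.
        by rewrite (map_inj_uniq (act_inj ghf HT)).
      by move=> z; rewrite !mem_rev => /onTb on /off[].
    move=> z zq; rewrite mem_cat !mem_rev => /orP[/onTb|zq0].
      by have [] := fq0off z zq.
    have [x xq0 zE] := mapP zq.
    have hq0 x' : x' \in q0 -> h x' <= h u + (c * D)%:Z /\ h u <= h x' + (c * D)%:Z.
      move=> x'q; have x'P : x' \in u :: rcons q0 w by rewrite inE mem_rcons inE x'q !orbT.
      have [j1 j2 _ _] := path_heights e_sym step pq0 x'P.
      have : (c * size (rcons q0 w) <= c * D)%N by rewrite leq_mul2l size_rcons sq0 orbT.
      by move: j1 j2; clear; lia.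
    have [i1 i2] := hq0 _ xq0; have [i3 i4] := hq0 _ zq0.
    move: i3; rewrite zE f_height; move: i2 f_high; rewrite -/period; clear; lia.
  move=> z /ona on; rewrite !mem_cat !mem_rev => /or3P[/fq0off[]|/onTb on'|/off[]] //.
  exact: (lift_disjoint dis on on').
have oc : f o \in c0.
  have : f o \in u :: p2.
    by rewrite -lp pE last_cat /= mem_last.
  by rewrite /c0 /closing_cycle mem_cat -cat_cons mem_cat => ->.
suff sc : size c0 = (n + n + size q0 + size q0).+2 by exact: And4.
rewrite /c0 /closing_cycle.
rewrite !(size_cat, size_rev, size_map, size_rcons) /=.
rewrite !(size_cat, size_map, size_rcons).
move: sp sp'; rewrite pE p'E !size_cat /=; clear; lia.
Qed.

End Pair.

(** The lengths of the pieces cut the polygon into arcs.  The first arc gives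
    p at once.  The second is known up to the unknown transformation
    f^k rho^m, which is determined by its value at f o. *)
Lemma closing_cycle_inj n (p p' P P' : seq V) k m p1 u p2 q1 y q2 q0
    k' m' P1 U P2 Q1 Y Q2 Q0 :
  size p = n -> size P = n -> size p' = n -> size P' = n ->
  last o p' = f o -> last o P' = f o ->
  p = p1 ++ u :: p2 -> p' = q1 ++ y :: q2 ->
  P = P1 ++ U :: P2 -> P' = Q1 ++ Y :: Q2 ->
  size p1 = size P1 -> size q1 = size Q1 -> size q0 = size Q0 ->
  closing_cycle (translate k m) p1 u p2 q1 y q2 q0 =
    closing_cycle (translate k' m') P1 U P2 Q1 Y Q2 Q0 ->
  p = P /\ p' = P'.
Proof.
move=> sp sP sp' sP' lp' lP' pE p'E PE P'E s1 s2 s0.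
have sp2 : size p2 = size P2.
  by move: sp sP s1; rewrite pE PE !size_cat /=; clear; lia.
have sq2 : size q2 = size Q2.
  by move: sp' sP' s2; rewrite p'E P'E !size_cat /=; clear; lia.
have inj_f := inj_map (act_inj ghf Hf).
move/eqP; rewrite /closing_cycle eqseq_cat; last first.
  by rewrite /= !size_cat !size_map !size_rcons sp2 s1.
move=> /andP[/eqP arc /eqP rest]; split.
  move/eqP: arc; rewrite -!cat_cons eqseq_cat/= ?sp2// => /andP[/eqP + /eqP /inj_f].
  by rewrite pE PE => -> /rcons_inj[->].
move/eqP: rest; rewrite eqseq_cat ?size_map ?s0// => /andP[_].
rewrite eqseq_cat; last first.
  by rewrite !size_rev !size_map /= !size_cat !size_map !size_rcons sq2 s2.
move=> /andP[/eqP /(congr1 rev)]; rewrite !revK => /eqP + _.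
rewrite -!cat_cons !map_cat eqseq_cat ?size_map/= ?sq2//.
move=> /andP[/eqP arc1 /eqP arc2].
have ends : translate k m (f o) = translate k' m' (f o).
  rewrite -{1}lp' -lP' p'E P'E !last_cat /=.
  by have := congr1 (last (f o)) arc1; rewrite /= !last_map.
have [kk mm] := fpow_rpow_eq ends; rewrite -kk -mm in arc1 arc2.
have inj_T := inj_map (act_inj ghf (translate_act k m)).
rewrite p'E P'E.
have -> : y :: q2 = Y :: Q2 by apply: inj_T.
by move/inj_T: arc2 => /inj_f /rcons_inj[->].
Qed.

Lemma act_cycle a w : H a -> cycle e [seq a z | z <- w] = cycle e w.
Proof. by move=> Ha; case: w => //= x w; rewrite -map_rcons (act_path ghf). Qed.

(** A pair of bridges is encoded by the length d of its connection, the closing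
    polygon moved by the inverse of f and rotated to start at o, the amount i
    of that rotation, and the positions a and b of u and y on the two bridges. *)
Lemma anchored_bridges_square n : (0 < n)%N ->
  (size (anchored_bridges e o h f n) * size (anchored_bridges e o h f n) <=
   \sum_(d <- iota 0 D)
     set_card (polygons e o (n + n + d + d).+2) * size (neighbours e o) *
     ((n + n + d + d).+2 * (n * n)))%N.
Proof.
move=> n0; set B := anchored_bridges e o h f n.
pose N d := (n + n + d + d).+1.
pose t := [seq (d, x) | d <- iota 0 D,
  x <- [seq (q, y) | q <- rooted_cycles e o (N d),
  y <- [seq (i, z) | i <- iota 0 (N d).+1,
  z <- [seq (a, b) | a <- iota 0 n, b <- iota 0 n]]]].
apply: (@leq_trans (size t)); last first.
  rewrite /t size_allpairs_dep sumnE big_map; apply: leq_sum => d _.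
  rewrite !size_allpairs !size_iota; apply: leq_mul => //.
  by apply: rooted_cycles_le => //; move: n0; rewrite /N; clear; lia.
pose code (pp : seq V * seq V) (x : nat * (seq V * (nat * (nat * nat)))) :=
  exists k m p1 u p2 q1 y q2 q0,
  [/\ pp.1 = p1 ++ u :: p2, pp.2 = q1 ++ y :: q2,
    [/\ size p1 = x.2.2.2.1, size q1 = x.2.2.2.2 & size q0 = x.1] &
    rot x.2.2.1 [seq g z | z <- closing_cycle (translate k m) p1 u p2 q1 y q2 q0]
      = o :: x.2.1].
rewrite -(size_allpairs pair B B); apply: (@size_le_code _ _ _ _ code).
- by apply: allpairs_uniq; rewrite ?uniq_walks_with// => -[? ?] [? ?] _ _ [-> ->].
- move=> _ /allpairsP[[p p'] /= [pB p'B ->]].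
  move: pB p'B => /(anchored_bridgesP o h e_lf)[bp lp sp].
  move=> /(anchored_bridgesP o h e_lf)[bp' lp' sp'].
  have [m [u [y [q0 [[dis up yp'] [k [pq uq sq off]]]]]]] := connection bp lp bp' lp'.
  have [p1 [p2 pE]] : exists p1 p2, p = p1 ++ u :: p2.
    by case/splitPr: up => p1 p2; exists p1, p2.
  have [q1 [q2 p'E]] : exists q1 q2, p' = q1 ++ y :: q2.
    by case/splitPr: yp' => q1 q2; exists q1, q2.
  have [cc uc oc sc] := closing_cycleP bp lp sp bp' lp' sp' pE p'E dis pq uq sq off.
  set w := closing_cycle _ _ _ _ _ _ _ _ in cc uc oc sc.
  have ow : o \in [seq g z | z <- w] by rewrite -[o]fK; apply: map_f.
  have [i q rotE] := rot_to ow.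
  (* oversized rotations are the identity, so the amount may be taken small *)
  have [j [jw rotj]] : exists j,
      (j < size w)%N /\ rot j [seq g z | z <- w] = o :: q.
    case: (leqP (size w) i) => [w_i|i_w]; last by exists i.
    exists 0%N; split; first by rewrite sc.
    by rewrite -rotE rot0 rot_oversize// size_map.
  exists (size q0, (q, (j, (size p1, size q1)))); last first.
    by exists k, m, p1, u, p2, q1, y, q2, q0.
  have szq : size q = N (size q0).
    by have := congr1 size rotj; rewrite size_rot size_map sc => -[].
  apply/allpairsPdep; exists (size q0), (q, (j, (size p1, size q1))).
  split=> //; first by rewrite mem_iota /= add0n.
  apply: allpairs_f.
    rewrite mem_rooted_cycles// szq eqxx -rotj rot_cycle rot_uniq act_cycle// cc.
    by rewrite (map_inj_uniq (act_inj ghf Hg)) uc.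
  apply: allpairs_f; first by rewrite mem_iota /= add0n -sc.
  have lt_n v1 (v : V) v2 : size (v1 ++ v :: v2) = n -> size v1 \in iota 0 n.
    by move=> <-; rewrite mem_iota size_cat /= -addSnnS leq_addr.
  by apply: allpairs_f; [apply: (lt_n _ u p2)|apply: (lt_n _ y q2)]; rewrite -?pE -?p'E.
move=> pp1 pp2 [d [q [i [a b]]]] /allpairsP[[p p'] /= [pB p'B ->]].
move=> /allpairsP[[P P'] /= [PB P'B ->]] _.
move: pB p'B PB P'B => /(anchored_bridgesP o h e_lf)[_ _ sp].
move=> /(anchored_bridgesP o h e_lf)[_ lp' sp'] /(anchored_bridgesP o h e_lf)[_ _ sP].
move=> /(anchored_bridgesP o h e_lf)[_ lP' sP'].
move=> [k [m [p1 [u [p2 [q1 [y [q2 [q0 [pE p'E [s1 s2 s0] rot1]]]]]]]]]].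
move=> [k' [m' [P1 [U [P2 [Q1 [Y [Q2 [Q0 [PE P'E [S1 S2 S0] rot2]]]]]]]]]].
rewrite -rot2 in rot1.
have {}rot1 := inj_map (act_inj ghf Hg) (rot_inj rot1).
rewrite -S1 in s1; rewrite -S2 in s2; rewrite -S0 in s0.
by have [-> ->] := closing_cycle_inj sp sP sp' sP' lp' lP' pE p'E PE P'E s1 s2 s0 rot1.
Qed.
End SquareHeight.

(** * Growth rates *)

Section Roots.
Variable R : realType.
Implicit Types x y C tau : R.
Local Open Scope ring_scope.

Lemma exponential_unbounded tau C : 1 < tau ->
  exists n0, forall n, (n0 <= n)%N -> C <= tau ^+ n.
Proof.
move=> tau1; have [K K0 lin] := linear_le_exponential tau1.
have CK0 : 0 <= `|C| * K by rewrite mulr_ge0// ltW.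
exists (Num.bound (`|C| * K)) => n n0; apply: le_trans (ler_norm C) _.
rewrite -(ler_pM2r K0) mulrC; rewrite [leRHS]mulrC (mulrC K); apply: le_trans (lin n).
apply: ltW; apply: lt_le_trans (archi_boundP CK0) _.
by rewrite ler_nat; exact: leqW.
Qed.

Lemma exponential_absorbs x y C : 0 < x -> x < y ->
  exists n0, forall n, (n0 <= n)%N -> C * x ^+ n <= y ^+ n.
Proof.
move=> x0 xy; have tau1 : 1 < y / x by rewrite ltr_pdivlMr ?mul1r.
have [n0 n0P] := exponential_unbounded C tau1; exists n0 => n /n0P.
by rewrite expr_div_n ler_pdivlMr ?exprn_gt0.
Qed.

Lemma root_expr y n : 0 <= y -> (0 < n)%N -> (y ^+ n) `^ n%:R^-1 = y.
Proof.
move=> y0 n0; rewrite -powR_mulrn// -powRrM mulfV ?powRr1//.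
by rewrite pnatr_eq0 -lt0n.
Qed.

Lemma root_le x y n : 0 <= x -> 0 <= y -> (0 < n)%N -> x <= y ^+ n ->
  x `^ n%:R^-1 <= y.
Proof.
move=> x0 y0 n0 le_x; rewrite -[leRHS](root_expr y0 n0).
by rewrite ge0_ler_powR ?nnegrE ?invr_ge0 ?exprn_ge0.
Qed.

Lemma root_ge x y n : 0 <= y -> (0 < n)%N -> y ^+ n <= x ->
  y <= x `^ n%:R^-1.
Proof.
move=> y0 n0 le_x; rewrite -[leLHS](root_expr y0 n0).
rewrite ge0_ler_powR ?nnegrE ?invr_ge0 ?exprn_ge0//.
by apply: le_trans le_x; rewrite exprn_ge0.
Qed.

Lemma limn_esup_eq (u : nat -> R) (l : R) :
  (forall eps, 0 < eps -> exists N, forall n, (N <= n)%N -> u n <= l + eps) ->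
  (forall eps, 0 < eps -> forall N, exists2 n, (N <= n)%N & l - eps <= u n) ->
  limn_esup (fun n => (u n)%:E) = l%:E.
Proof.
move=> up lo; apply/eqP; rewrite eq_le; apply/andP; split.
  apply/lee_addgt0Pr => eps eps0; have [N NP] := up eps eps0.
  apply: (@le_trans _ _ (ereal_sup [set (u n)%:E | n in [set n | (N <= n)%N]])).
    by apply: ereal_inf_lbound; exists [set n | (N <= n)%N] => //; exists N.
  by apply: ge_ereal_sup => _ [n /= Nn <-]; rewrite -EFinD lee_fin NP.
apply: le_ereal_inf_tmp => _ [W [N _ NW] <-].
apply/lee_addgt0Pr => eps eps0; have [n Nn le_n] := lo eps eps0 N.
apply: (@le_trans _ _ ((u n)%:E + eps%:E)%E).
  by rewrite -EFinD lee_fin -lerBlDr.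
by rewrite leeD2r//; apply: ereal_sup_ubound; exists n => //; exact: NW.
Qed.

End Roots.

Section Square.
Variables (V : choiceType) (e : rel V) (o : V) (h : V -> int)
  (H : set (V -> V)) (rho : V -> V) (R : realType).
Hypotheses (e_sym : symmetric e) (e_lf : locally_finite e)
  (e_conn : graph_connected e)
  (sghf : square_graph_height_function e o h H rho)
  (sub : subexponential_growth R e o).
Local Open Scope ring_scope.

Let ghf : graph_height_function e o h H. Proof. by case: sghf. Qed.

(** With t' = th * t, there are at least t' ^+ (2 * m) pairs of bridges, while
    the encoding of [anchored_bridges_square] leaves only a cubic factor in m and
    constants.  The remaining two factors th between t'' and t' give a surplus
    tau ^+ (4 * m) on squaring, which absorbs the cubic factor and every
    constant. *)
Lemma many_polygons (t'' t : R) (N0 : nat) : 0 < t'' -> t'' < t ->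
  ~ bridges_grow_slower e h t ->
  exists2 N, (N0 <= N)%N & t'' ^+ N <= (set_card (polygons e o N))%:R.
Proof.
move=> t''0 t''t fast; have [_ Hrho tr rho_h comm] := sghf.
have [c step] := height_step_bound e_lf ghf.
have [D disp] := central_displacement_bound e_conn ghf Hrho comm.
have [th [th0 th1 t''_le]] := exists_root_between 3 t''0 t''t.
have t0 : 0 < t by apply: lt_trans t''t.
pose tau := th^-1; have tau1 : 1 < tau by rewrite invf_gt1.
have tau0 : 0 < tau by rewrite invr_gt0.
pose t' := th * t; have t'0 : 0 < t' by rewrite mulr_gt0.
have t't : t' < t by rewrite gtr_pMl.
have [L L0 lin] := linear_le_exponential tau1.
pose deg := (size (neighbours e o))%:R : R.
pose C := D%:R * (deg * (1 + t'') ^+ D.+1.*2 * (D.+1.*2%:R * L ^+ 3)).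
have [n0 n0P] := exponential_unbounded (C + 1) tau1.
(* this height separates a connection from its image under f *)
have [m [f [Hf big_m rise many]]] := many_anchored_bridges e_sym e_lf e_conn
  ghf sub (c * D).*2.+1 (maxn N0 n0).+1 t'0 t't fast.
have [g [Hg fK gK]] := act_inv ghf Hf.
have f_high : (c * D).*2%:Z < h (f o) by apply: lt_le_trans rise; rewrite ltz_nat.
have m0 : (0 < m)%N by apply: leq_trans big_m.
have := anchored_bridges_square e_sym e_lf ghf Hrho tr rho_h comm step disp Hf Hg
  fK gK f_high m0.
set B := size _ in many *; set N := fun d => (m + m + d + d).+2.
rewrite -(ler_nat R) natrM natr_sum => le_sum.
apply: contrapT => no_polygon.
have few n : (N0 <= n)%N -> (set_card (polygons e o n))%:R < t'' ^+ n.
  by move=> N0n; rewrite ltNge; apply/negP => ge; apply: no_polygon; exists n.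
pose X := t'' ^+ m; pose Y := tau ^+ m.
have X0 : 0 < X by rewrite exprn_gt0.
have Y0 : 0 < Y by rewrite exprn_gt0.
have term d : (d < D)%N ->
    (set_card (polygons e o (N d)) * size (neighbours e o) * (N d * (m * m)))%:R <=
    (X ^+ 2 * (1 + t'') ^+ D.+1.*2) * deg * (D.+1.*2%:R * L ^+ 3 * Y ^+ 3).
  move=> dD; rewrite !natrM; apply: ler_pM => //.
    rewrite -/deg ler_wpM2r//; apply: le_trans (ltW (few _ _)) _.
      by move: big_m; rewrite /N gtn_max; clear; lia.
    have -> : t'' ^+ N d = X ^+ 2 * t'' ^+ (d + d).+2.
      by rewrite -exprM -exprD /N; congr (_ ^+ _); clear; lia.
    apply: ler_wpM2l; first by rewrite exprn_ge0// ltW.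
    apply: (@le_trans _ _ ((1 + t'') ^+ (d + d).+2)).
      by rewrite lerXn2r ?nnegrE ?addr_ge0 ?(ltW t''0)// lerDr.
    by rewrite ler_weXn2l ?lerDl ?(ltW t''0)//; move: dD; clear; lia.
  apply: (@le_trans _ _ (D.+1.*2%:R * m.+1%:R ^+ 3)).
    rewrite -natrX -!natrM ler_nat /N; move: dD; clear; nia.
  rewrite -mulrA ler_wpM2l// -exprMn lerXn2r ?nnegrE ?mulr_ge0 ?(ltW L0) ?(ltW Y0)//.
have le_C : t' ^+ m * t' ^+ m <= C * (X ^+ 2 * Y ^+ 3).
  apply: (@le_trans _ _ (B%:R * B%:R)); first by apply: ler_pM; rewrite ?exprn_ge0 ?(ltW t'0).
  apply: le_trans le_sum _; rewrite big_seq.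
  apply: (@le_trans _ _ (\sum_(d <- iota 0 D)
    ((X ^+ 2 * (1 + t'') ^+ D.+1.*2) * deg * (D.+1.*2%:R * L ^+ 3 * Y ^+ 3)))).
    rewrite [leRHS]big_seq; apply: ler_sum => d; rewrite mem_iota add0n => /andP[_].
    exact: term.
  rewrite big_const_seq count_predT size_iota iter_addr_0 -[_ *+ D]mulr_natl /C.
  by rewrite [leLHS](AC (1*(3*3)) ((1*(4*3*(5*6)))*(2*7))).
have t'_ge : tau ^+ 2 * t'' <= t'.
  rewrite /t' /tau exprVn ler_pdivrMl ?exprn_gt0// mulrA -exprSr.
  exact: t''_le.
have : Y <= C.
  rewrite -(@ler_pM2r _ (X ^+ 2 * Y ^+ 3)) ?mulr_gt0 ?exprn_gt0//.
  apply: le_trans le_C.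
  have t'm : Y ^+ 2 * X <= t' ^+ m.
    rewrite /Y /X -exprM mulnC exprM -exprMn.
    by rewrite lerXn2r ?nnegrE ?mulr_ge0 ?exprn_ge0//; exact: ltW.
  apply: le_trans (ler_pM _ _ t'm t'm); last 2 first.
  - by rewrite mulr_ge0 ?exprn_ge0// ltW.
  - by rewrite mulr_ge0 ?exprn_ge0// ltW.
  by rewrite !exprS !expr0 !mulr1 [leLHS](AC (1*(2*(1*2))) (((1*4)*2)*((5*6)*3))).
apply/negP; rewrite -ltNge; apply: (@lt_le_trans _ _ (C + 1)).
  by rewrite ltrDl.
by apply: n0P; move: big_m; rewrite gtn_max; clear; lia.
Qed.

Lemma bridges_grow_slowerW (t t' : R) : 0 < t -> t <= t' ->
  bridges_grow_slower e h t -> bridges_grow_slower e h t'.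
Proof.
move=> t0 tt' [K K0 le_K]; exists K => // v n; apply: le_trans (le_K v n) _.
by rewrite ler_wpM2l ?(ltW K0)// lerXn2r ?nnegrE ?(ltW t0)// (le_trans (ltW t0)).
Qed.

(** There is at least one bridge of each length, so the growth rate of bridges
    is at least 1; the value 1/2 leaves room for a multiplicative constant. *)
Lemma bridges_grow_at_least_half : ~ bridges_grow_slower e h (2^-1 : R).
Proof.
move=> [K K0 le_K]; have [L L0 lin] := @linear_le_exponential R 2 (ltr1n _ 2).
pose n := Num.bound (L * K).
have [p asc sp] := ascending_from ghf o n.
have : 1 <= K * 2^-1 ^+ n.
  apply: le_trans (le_K o n); rewrite ler1n lt0n size_eq0.
  apply/negP => /eqP E.
  have : p \in walks_with e (bridge e h o) o n.
    by rewrite mem_walks_with// (ascending_bridge asc) (ascending_path asc) sp eqxx.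
  by rewrite E.
rewrite exprVn ler_pdivlMr ?exprn_gt0// mul1r leNgt => /negP; apply.
rewrite -(ltr_pM2l L0); apply: lt_le_trans (lin n).
apply: (lt_trans (archi_boundP _)); first by rewrite mulr_ge0// ltW.
by rewrite ltr_nat.
Qed.

Definition fast_rates := [set t : R | 0 < t /\ ~ bridges_grow_slower e h t].

(** The property [bridges_grow_slower] is monotone in the rate, so the threshold
    l is the supremum of the rates at which it fails. *)
Lemma bridge_rate_exists : exists2 l : R, 0 < l &
  (forall t, 0 < t -> t < l -> ~ bridges_grow_slower e h t) /\
  (forall t, l < t -> bridges_grow_slower e h t).
Proof.
have half : fast_rates 2^-1.
  by split; [rewrite invr_gt0|exact: bridges_grow_at_least_half].
have [D D1 le_D] := bridges_le_exponential R e_lf ghf.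
have D0 : 0 < D by apply: lt_le_trans D1.
have ub : has_ubound fast_rates.
  exists D => t [t0 fast]; rewrite leNgt; apply/negP => Dt; apply: fast.
  apply: bridges_grow_slowerW D0 (ltW Dt) _.
  by exists 1 => // v n; rewrite mul1r.
exists (sup fast_rates).
  by apply: lt_le_trans (ub_le_sup ub half); rewrite invr_gt0.
split=> [t t0 t_lt slow|t lt_t].
  have ne : fast_rates !=set0 by exists 2^-1.
  have [t1 [_ fast] tt1] := sup_gt ne t_lt.
  exact/fast/(bridges_grow_slowerW t0 (ltW tt1)).
apply: contrapT => fast; have : t <= sup fast_rates.
  apply: ub_le_sup => //; split=> //; apply: lt_trans lt_t.
  by apply: lt_le_trans (ub_le_sup ub half); rewrite invr_gt0.
by rewrite leNgt lt_t.
Qed.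

Lemma set_card_saws n :
  set_card (saws e o n) = size (walks_with e (fun p => uniq (o :: p)) o n).
Proof.
apply: set_cardE => [|p]; first exact: uniq_walks_with.
rewrite mem_walks_with//; split=> [[pp up sp]|/and3P[up pp /eqP sp]] //.
by apply/and3P; rewrite sp.
Qed.

Lemma saws_le_rate (t y : R) : 0 < t -> t < y -> bridges_grow_slower e h t ->
  exists2 C, 0 < C & forall n, (set_card (saws e o n))%:R <= C * y ^+ n.
Proof.
move=> t0 ty [K K0 le_K]; have [c step] := height_step_bound e_lf ghf.
have [C C0 le_C] := saw_count_le e_sym e_lf step (lower_neighbour ghf)
  (few_walk_ends e_sym e_lf e_conn ghf sub) K0 t0 ty le_K.
by exists C => // n; rewrite set_card_saws.
Qed.

(** A rooted polygon of n steps is determined by a self-avoiding walk of n - 1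
    steps, whence the division by y. *)
Lemma polygons_le_rate (C y : R) : 0 < y ->
  (forall n, (set_card (saws e o n))%:R <= C * y ^+ n) ->
  forall n, (set_card (polygons e o n))%:R <= C / y * y ^+ n.
Proof.
move=> y0 le_C n.
have C0 : 0 <= C by have := le_C 0%N; rewrite expr0 mulr1; exact: le_trans.
have [n3|n3] := leqP 3 n; last first.
  have -> : polygons e o n = set0.
    by apply/seteqP; split=> // E [/=]; rewrite leqNgt n3.
  by rewrite /set_card fset_set0 mulr_ge0 ?exprn_ge0 ?(ltW y0)// divr_ge0// ltW.
case: n n3 => // n n3; apply: le_trans (_ : C * y ^+ n <= _).
  apply: le_trans (le_C n); rewrite ler_nat set_card_saws.
  exact: card_polygons_le.
by rewrite exprS mulrA divfK// gt_eqF.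
Qed.

(** Both sides equal the growth rate l of bridges. *)
Lemma polygon_constant_eq :
  polygon_constant R e o = (connective_constant R e o)%:E.
Proof.
have [l l0 [fast slow]] := bridge_rate_exists.
have saws_up eps : 0 < eps -> exists2 C, 0 < C &
    forall n, (set_card (saws e o n))%:R <= C * (l + eps / 2) ^+ n.
  move=> eps0; have lt1 : l < l + eps / 2 / 2 by rewrite ltrDl !divr_gt0.
  apply: saws_le_rate (slow _ lt1); first exact: lt_trans lt1.
  by rewrite ltrD2l gtr_pMr ?divr_gt0// invf_lt1// ltr1n.
have lt2 eps : 0 < eps -> l + eps / 2 < l + eps.
  by move=> eps0; rewrite ltrD2l gtr_pMr// invf_lt1// ltr1n.
have pos eps : 0 < eps -> 0 < l + eps by move=> eps0; rewrite addr_gt0.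
have root_up (u : nat -> nat) C eps : 0 < eps ->
    (forall n, (u n)%:R <= C * (l + eps / 2) ^+ n) ->
    exists N, forall n, (N <= n)%N -> (u n)%:R `^ n%:R^-1 <= l + eps.
  move=> eps0 le_C.
  have [N NP] := exponential_absorbs C (pos _ (divr_gt0 eps0 (ltr0n _ 2))) (lt2 _ eps0).
  exists N.+1 => n Nn; apply: root_le => //; first exact/ltW/pos.
    exact: leq_trans Nn.
  by apply: le_trans (le_C n) _; apply: NP; exact: ltnW.
have -> : connective_constant R e o = l.
  apply: cvg_lim => //; apply/cvgrPdist_le => eps eps0.
  have [C C0 le_C] := saws_up _ eps0.
  have [N1 N1P] := root_up _ C eps eps0 le_C.
  have [N2 N2P] : exists N, forall n, (N <= n)%N ->
      l - eps <= (set_card (saws e o n))%:R `^ n%:R^-1.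
    have [le0|gt0] := leP (l - eps) 0.
      by exists 0%N => n _; apply: le_trans le0 _; exact: powR_ge0.
    pose t := l - eps / 2 / 2; pose t' := l - eps / 2.
    have t_lt : t < l by rewrite ltrBlDr ltrDl !divr_gt0.
    have t't : t' < t by rewrite ltrD2l ltrN2 gtr_pMr ?divr_gt0// invf_lt1// ltr1n.
    have lt_t' : l - eps < t' by rewrite ltrD2l ltrN2 gtr_pMr// invf_lt1// ltr1n.
    have t'0 : 0 < t' by exact: lt_trans lt_t'.
    have [m [f [Hf m0 _ many]]] := many_anchored_bridges e_sym e_lf e_conn ghf sub 0
      1 t'0 t't (fast _ (lt_trans t'0 t't) t_lt).
    have [b b0 le_b] := saw_count_ge e_lf ghf t'0 m0 Hf many.
    have [n0 n0P] := exponential_absorbs b^-1 gt0 lt_t'.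
    exists n0.+1 => n n0n; apply: root_ge; [exact: ltW|exact: leq_trans n0n|].
    rewrite set_card_saws; apply: le_trans (le_b n).
    by rewrite -ler_pdivrMl// n0P// ltnW.
  exists (maxn N1 N2) => // n /=; rewrite geq_max => /andP[n1 n2].
  by rewrite ler_distlC N2P ?N1P.
apply: limn_esup_eq => eps eps0.
  have [C C0 le_C] := saws_up _ eps0.
  exact: root_up eps0 (polygons_le_rate (pos _ (divr_gt0 eps0 (ltr0n _ 2))) le_C).
move=> N; have [le0|gt0] := leP (l - eps) 0.
  by exists N => //; apply: le_trans le0 _; exact: powR_ge0.
pose t := l - eps / 2.
have t_lt : t < l by rewrite ltrBlDr ltrDl divr_gt0.
have lt_t : l - eps < t by rewrite ltrD2l ltrN2 gtr_pMr// invf_lt1// ltr1n.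
have [n Nn le_n] := many_polygons N.+1 gt0 lt_t (fast _ (lt_trans gt0 lt_t) t_lt).
exists n; first exact: ltnW.
by apply: root_ge le_n; [exact: ltW|exact: leq_trans Nn].
Qed.

End Square.

Theorem theorem1p1 (R : realType) (V : choiceType) (e : rel V) (o : V)
    (e_sym : symmetric e) (e_irr : irreflexive e)
    (V_inf : infinite_set [set: V])
    (e_conn : graph_connected e)
    (e_lf : locally_finite e)
    (e_qt : quasi_transitive e)
    (e_sghf : exists (h : V -> int) (H : set (V -> V)) (rho : V -> V),
        square_graph_height_function e o h H rho)
    (e_growth : subexponential_growth R e o) :
  polygon_constant R e o = (connective_constant R e o)%:E.
Proof.
by have [h [H [rho sghf]]] := e_sghf; exact: polygon_constant_eq sghf e_growth.
Qed.
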